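(* Let $\overline M=M\cup\partial M$ be an oriented smooth manifold of dimension $n\geq 3$ with boundary $\partial M$ and interior $M$, and let $\mathcal G$ be an equivalence class of ALH metrics on $M$ for the relation $\sim_{n-2}$. Let $c:=\frac1nc_1+\frac12c_2$, with $c_1,c_2$ the cocycles on $\mathcal G$ defined in the context. Then $c$ is a cocycle on $\mathcal G$ with values in $\Omega^{n-1}(\partial M,\mathcal T\partial M)$ (i.e. $c(h,g)=-c(g,h)$ and $c(g,k)=c(g,h)+c(h,k)$ for all $g,h,k\in\mathcal G$), and for all $g,h\in\mathcal G$ and every diffeomorphism $\Phi\in\operatorname{Diff}_0^{n+1}(\overline M)$ one has $$c(g,h)=c(g,\Phi^*h).$$
   Context: All objects are $C^\infty$; abstract index notation is used. Setting. A local defining function for $\partial M$ is a smooth $\rho:U\to[0,\infty)$, $U\subset\overline M$ open, with $U\cap\partial M=\rho^{-1}(0)$ and $d\rho$ nowhere zero on $U\cap\partial M$; $\rho_a$ denotes $d\rho$. A tensor field (or function) is $\mathcal O(\rho^k)$, $k>0$, if near boundary points it equals $\rho^k$ times one that is smooth up to the boundary. A Riemannian metric $g$ on $M$ is conformally compact if near each boundary point $\rho^2g$ extends smoothly to the boundary with non-degenerate boundary values, for some (equivalently any) local defining function; it is ALH if in addition $(\rho^2g)^{-1}(d\rho,d\rho)\equiv1$ along $\partial M$. For conformally compact $g,h$ write $g\sim_{n-2}h$ if $\rho^2g-\rho^2h=\mathcal O(\rho^n)$. All metrics in $\mathcal G$ induce the same conformal structure $[\mathcal G_\infty]$ on $\partial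 M$ (the class of the boundary values of $\rho^2g$). $\operatorname{Diff}_0^{n+1}(\overline M)$ is the set of diffeomorphisms $\Phi$ of $\overline M$ asymptotic to the identity of order $n+1$: $f\circ\Phi-f=\mathcal O(\rho^{n+1})$ for every $f\in C^\infty(\overline M,\mathbb R)$. (Such $\Phi$ satisfy $\Phi^*\mathcal G=\mathcal G$.) Cocycles. Given $g,h\in\mathcal G$ and a local defining function $\rho$: $\mu_{ij}$ and $\mu$ (smooth up to the boundary) are defined by $h_{ij}=g_{ij}+\rho^{n-2}\mu_{ij}$ and $g^{ij}\mu_{ij}=\rho^2\mu$, and $\mu^0_{ij}=\mu_{ij}-\frac1n\rho^2\mu g_{ij}$; $\overline g=\rho^2g$ and $\overline g_\infty$ is the metric it induces on $\partial M$; $\overline\sigma_\infty\in\Gamma(\mathcal E[1])$ is the $1$-density on $\partial M$ corresponding to $\overline g_\infty$ (i.e. $\overline g_\infty=\overline\sigma_\infty^{-2}\mathbf g$ with $\mathbf g$ the conformal metric of $[\mathcal G_\infty]$); $\operatorname{vol}_{\overline g_\infty}$ is the volume form of $\overline g_\infty$ with $\operatorname{vol}_{\overline g}=d\rho\wedge\operatorname{vol}_{\overline g_\infty}$ along $\partial M$. Then $$c_1(g,h)=\tfrac{n^2-1}{2}\operatorname{vol}_{\overline g_\infty}\mu|_{\partial M}\,\overline\sigma_\infty^{-1}\mathbf X^A,\qquad c_2(g,h)=-\overline g^{ij}\overline g^{k\ell}\rho_i\rho_k\mu^0_{j\ell}|_{\partial M}\operatorname{vol}_{\overline g_\infty}\overline\sigma_\infty^{-1}\mathbf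 X^A ,$$ which are independent of $\rho$. Boundary tractor bundle. $\mathcal E[w]$ is the bundle of densities of weight $w$ (with $\mathcal E[2(n-1)]=\otimes^2\Lambda^{n-1}T\partial M$ on $\partial M$), and $B[w]=B\otimes\mathcal E[w]$. The standard tractor bundle $\mathcal T\partial M$ of $(\partial M,[\mathcal G_\infty])$ has rank $n+1$: each metric in $[\mathcal G_\infty]$ gives an isomorphism $\mathcal T\partial M\cong\mathcal E[1]\oplus\mathcal E_a[1]\oplus\mathcal E[-1]$, written as triples $(\sigma,\mu_a,\nu)$, and for $\widehat\gamma=e^{2f}\gamma$, $\Upsilon=df$, these are related by $\widehat\sigma=\sigma$, $\widehat\mu_a=\mu_a+\Upsilon_a\sigma$, $\widehat\nu=\nu-\mathbf g^{ij}(\Upsilon_i\mu_j+\frac12\Upsilon_i\Upsilon_j\sigma)$. $\mathbf X^A=(0,0,1)\in\Gamma(\mathcal T\partial M[1])$ is the canonical section. *)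

(* Defs.v *)
From mathcomp Require Import all_boot all_order all_algebra.
From mathcomp Require Import all_classical all_reals all_analysis.
Import Order.TTheory GRing.Theory Num.Theory.
Import numFieldNormedType.Exports.

Set Implicit Arguments.
Unset Strict Implicit.
Unset Printing Implicit Defensive.

Local Open Scope classical_set_scope.
Local Open Scope ring_scope.

(* Conventions.
   - The manifold with boundary has dimension n = m.+1; its boundary has
     dimension m = n - 1.
   - Tensor fields are given in the classical way, by their components in each
     chart of the atlas, with a transformation law on overlaps.  The values of
     such a family outside the domain of the chart (or outside the interior,
     resp. boundary, for objects living there) are irrelevant.
   - 'J f x is the library's Jacobian acting on row vectors, so that
     ('J f x) i j is the partial derivative of the j-th component of f in the
     i-th direction. *)

Definition ebase (R : realType) (n : nat) (i : 'I_n) : 'rV[R]_n :=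
  delta_mx ord0 i.

Fixpoint Ck (R : realType) (n k : nat) (U : set 'rV[R]_n) (f : 'rV[R]_n -> R)
    : Prop :=
  match k with
  | 0 => forall x, U x -> {for x, continuous f}
  | k'.+1 => (forall x, U x -> differentiable f x) /\
             forall v, Ck k' U (fun x => 'D_v f x)
  end.

(* C^oo on an arbitrary subset A (in practice relatively open in the closed
   half-space): local existence of C^oo extensions to open sets. *)
Definition smooth_on (R : realType) (n : nat) (A : set 'rV[R]_n)
    (f : 'rV[R]_n -> R) : Prop :=
  forall x, A x -> exists W F,
    [/\ open W, W x, forall k, Ck k W F & forall y, W y -> A y -> f y = F y].

Definition halfspace (R : realType) (m : nat) : set 'rV[R]_m.+1 :=
  [set x | 0 <= x ord0 ord0].

(* The orientation is encoded by the atlas: all its charts are positively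
   oriented.  The last field only asks for positive Jacobian determinants over
   interior points; at boundary points it then follows by continuity. *)
Record obmanifold (R : realType) (m : nat) := OBManifold {
  pt :> topologicalType;
  chart : Type;
  chart_at : pt -> chart;
  dom : chart -> set pt;
  crd : chart -> pt -> 'rV[R]_m.+1;
  pnt : chart -> 'rV[R]_m.+1 -> pt;
  pt_hausdorff : hausdorff_space pt;
  pt_second_countable : @second_countable pt;
  dom_open : forall a, open (dom a);
  dom_chart_at : forall p, dom (chart_at p) p;
  crdK : forall a p, dom a p -> pnt a (crd a p) = p;
  crd_image : forall a, exists O : set 'rV[R]_m.+1,
    open O /\ crd a @` dom a = O `&` @halfspace R m;
  crd_continuous : forall a, {within dom a, continuous (crd a)};
  pnt_continuous : forall a, {within crd a @` dom a, continuous (pnt a)};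
  transition_smooth : forall a b j,
    smooth_on (crd a @` (dom a `&` dom b))
              (fun x => crd b (pnt a x) ord0 j);
  transition_oriented : forall a b p, dom a p -> dom b p ->
    0 < crd a p ord0 ord0 -> 0 < \det ('J (crd b \o pnt a) (crd a p))
}.

Definition bd (R : realType) (m : nat) (M : obmanifold R m) : set M :=
  [set p | exists a, dom a p /\ crd a p ord0 ord0 = 0].

Definition inn (R : realType) (m : nat) (M : obmanifold R m) : set M :=
  ~` @bd R m M.

Arguments bd {R m} M.
Arguments inn {R m} M.

(* C^oo up to the boundary when V meets the boundary. *)
Definition smooth_fn (R : realType) (m : nat) (M : obmanifold R m)
    (V : set M) (f : M -> R) : Prop :=
  forall a, smooth_on (crd a @` (dom a `&` V)) (f \o pnt a).

Definition smooth_map (R : realType) (m : nat) (M : obmanifold R m)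
    (Phi : M -> M) : Prop :=
  continuous Phi /\
  forall a b j, smooth_on (crd a @` (dom a `&` Phi @^-1` dom b))
                          (fun x => crd b (Phi (pnt a x)) ord0 j).

Definition diffeomorphism (R : realType) (m : nat) (M : obmanifold R m)
    (Phi : M -> M) : Prop :=
  smooth_map Phi /\
  exists Psi, [/\ smooth_map Psi, cancel Phi Psi & cancel Psi Phi].

(* Value at p of the continuous extension of a function given on the
   interior. *)
Definition bval (R : realType) (m : nat) (M : obmanifold R m) (f : M -> R)
    (p : M) : R :=
  lim (f q @[q --> within (inn M) (nbhs p)]).

Definition bval_mx (R : realType) (m : nat) (M : obmanifold R m) (k l : nat)
    (f : M -> 'M[R]_(k, l)) (p : M) : 'M[R]_(k, l) :=
  \matrix_(i < k, j < l) bval (fun q => f q i j) p.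

(* Components at p of d rho.  At boundary points this is the extension of the
   derivatives taken in the interior, i.e. the (one-sided) derivative of a
   function smooth up to the boundary. *)
Definition dcomp (R : realType) (m : nat) (M : obmanifold R m) (a : chart M)
    (rho : M -> R) (p : M) : 'rV[R]_m.+1 :=
  \row_i bval (fun q => 'D_(@ebase R m.+1 i) (rho \o pnt a) (crd a q)) p.

Definition local_defining (R : realType) (m : nat) (M : obmanifold R m)
    (U : set M) (rho : M -> R) : Prop :=
  [/\ open U, smooth_fn U rho, forall p, U p -> 0 <= rho p,
      forall p, U p -> (rho p = 0 <-> bd M p)
    & forall a p, U p -> bd M p -> dom a p -> dcomp a rho p != 0].

Definition extends (R : realType) (m : nat) (M : obmanifold R m) (D : set M)
    (f : M -> R) (p : M) : Prop :=
  exists V u, [/\ open V, V p, smooth_fn V u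
                & forall q, V q -> D q -> f q = u q].

(* f, defined on D, is O(rho^k) near the boundary point p. *)
Definition bigO_rho (R : realType) (m : nat) (M : obmanifold R m) (D : set M)
    (rho : M -> R) (k : nat) (f : M -> R) (p : M) : Prop :=
  exists V u, [/\ open V, V p, smooth_fn V u
                & forall q, V q -> D q -> f q = rho q ^+ k * u q].

(* Component families of covariant 2-tensors, on M and on its boundary. *)
Definition cov2 (R : realType) (m : nat) (M : obmanifold R m) : Type :=
  chart M -> M -> 'M[R]_m.+1.

Definition bcov2 (R : realType) (m : nat) (M : obmanifold R m) : Type :=
  chart M -> M -> 'M[R]_m.

Definition sym_posdef (R : realType) (k : nat) (A : 'M[R]_k) : Prop :=
  A^T = A /\ forall v : 'rV[R]_k, v != 0 -> 0 < (v *m A *m v^T) ord0 ord0.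

Definition is_metric (R : realType) (m : nat) (M : obmanifold R m)
    (g : cov2 M) : Prop :=
  [/\ forall a p, dom a p -> inn M p -> sym_posdef (g a p),
      forall a i j, smooth_on (crd a @` (dom a `&` inn M))
                              (fun x => g a (pnt a x) i j)
    & forall a b p, dom a p -> dom b p -> inn M p ->
        let J := 'J (crd b \o pnt a) (crd a p) in
        g a p = J *m g b p *m J^T].

(* Boundary values of rho^2 g. *)
Definition gbar (R : realType) (m : nat) (M : obmanifold R m) (rho : M -> R)
    (g : cov2 M) (a : chart M) (p : M) : 'M[R]_m.+1 :=
  bval_mx (fun q => rho q ^+ 2 *: g a q) p.

Definition conformally_compact (R : realType) (m : nat) (M : obmanifold R m)
    (g : cov2 M) : Prop :=
  is_metric g /\
  forall U rho, local_defining U rho ->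
  forall a p, U p -> bd M p -> dom a p ->
    (forall i j, extends (inn M) (fun q => rho q ^+ 2 * g a q i j) p) /\
    \det (gbar rho g a p) != 0.

Definition ALH (R : realType) (m : nat) (M : obmanifold R m) (g : cov2 M)
    : Prop :=
  conformally_compact g /\
  forall U rho, local_defining U rho ->
  forall a p, U p -> bd M p -> dom a p ->
    (dcomp a rho p *m invmx (gbar rho g a p) *m (dcomp a rho p)^T)
      ord0 ord0 = 1.

(* The relation g ~_{n-2} h, where n = m.+1. *)
Definition asymp_equiv (R : realType) (m : nat) (M : obmanifold R m)
    (g h : cov2 M) : Prop :=
  forall U rho, local_defining U rho ->
  forall a p, U p -> bd M p -> dom a p -> forall i j,
    bigO_rho (inn M) rho m.+1
      (fun q => rho q ^+ 2 * g a q i j - rho q ^+ 2 * h a q i j) p.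

Definition ALH_class (R : realType) (m : nat) (M : obmanifold R m)
    (G : set (cov2 M)) : Prop :=
  exists2 g0, ALH g0 & G = [set h | ALH h /\ asymp_equiv g0 h].

Definition Diff0 (R : realType) (m : nat) (M : obmanifold R m) (k : nat)
    (Phi : M -> M) : Prop :=
  diffeomorphism Phi /\
  forall f : M -> R, smooth_fn [set: M] f ->
  forall U rho, local_defining U rho -> forall p, U p -> bd M p ->
    bigO_rho [set: M] rho k (fun q => f (Phi q) - f q) p.

Definition pullback (R : realType) (m : nat) (M : obmanifold R m)
    (Phi : M -> M) (h : cov2 M) : cov2 M := fun a q =>
  let b := chart_at (Phi q) in
  let J := 'J (crd b \o Phi \o pnt a) (crd a q) in
  J *m h b (Phi q) *m J^T.

(* Boundary charts: the last m coordinates of a chart, with x_0 = 0.  A local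
   defining function satisfies d rho = rho_0 dx_0, rho_0 > 0, along the
   boundary; so for the boundary orientation characterized by
   vol_gbar = d rho /\ vol_gbar_oo these charts are positively oriented. *)
Definition bcrd (R : realType) (m : nat) (M : obmanifold R m) (a : chart M)
    (p : M) : 'rV[R]_m :=
  \row_i crd a p ord0 (lift ord0 i).

Definition bpnt (R : realType) (m : nat) (M : obmanifold R m) (a : chart M)
    (y : 'rV[R]_m) : M :=
  pnt a (\row_j oapp (y ord0) 0 (unlift ord0 j)).

Definition smooth_bd (R : realType) (m : nat) (M : obmanifold R m)
    (a : chart M) (f : M -> R) : Prop :=
  smooth_on (bcrd a @` (dom a `&` bd M)) (f \o bpnt a).

Definition bjac (R : realType) (m : nat) (M : obmanifold R m) (a b : chart M)
    (p : M) : 'M[R]_m :=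
  'J (bcrd b \o bpnt a) (bcrd a p).

Definition is_bmetric (R : realType) (m : nat) (M : obmanifold R m)
    (gam : bcov2 M) : Prop :=
  [/\ forall a p, dom a p -> bd M p -> sym_posdef (gam a p),
      forall a i j, smooth_bd a (fun p => gam a p i j)
    & forall a b p, dom a p -> dom b p -> bd M p ->
        gam a p = bjac a b p *m gam b p *m (bjac a b p)^T].

(* The metric induced on the boundary by rho^2 g. *)
Definition gbar_oo (R : realType) (m : nat) (M : obmanifold R m)
    (rho : M -> R) (g : cov2 M) (a : chart M) (p : M) : 'M[R]_m :=
  \matrix_(i, j) gbar rho g a p (lift ord0 i) (lift ord0 j).

(* The conformal structure [G_oo]. *)
Definition conf_class (R : realType) (m : nat) (M : obmanifold R m)
    (G : set (cov2 M)) : set (bcov2 M) :=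
  [set gam | is_bmetric gam /\
    forall g, G g -> forall U rho, local_defining U rho ->
    forall p, U p -> bd M p ->
      exists2 l : R, 0 < l &
        forall a, dom a p -> gam a p = l *: gbar_oo rho g a p].

(* The 1-density of a metric A on the boundary: as E[2m] is the square of
   the top exterior power of the tangent bundle, the section det(A)^-1 of
   E[2m] has the 2m-th root below as component in E[1]. *)
Definition density1 (R : realType) (m : nat) (A : 'M[R]_m) : R :=
  (\det A) `^ (- ((m.*2)%:R)^-1).

(* Component of the volume form in a positively oriented chart. *)
Definition volform (R : realType) (m : nat) (A : 'M[R]_m) : R :=
  Num.sqrt (\det A).

(* Triples (sigma, mu_a, nu), and component families of standard tractor
   valued m-forms on the boundary: for a boundary chart and a metric of the
   conformal class (splitting the tractor bundle), the slots of the
   coefficient of dx_1 /\ ... /\ dx_m. *)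
Definition ttriple (R : realType) (m : nat) : Type :=
  (R^o * 'rV[R]_m * R^o)%type.

Definition tform (R : realType) (m : nat) (M : obmanifold R m) : Type :=
  chart M -> bcov2 M -> M -> ttriple R m.

Definition tsig (R : realType) (m : nat) (t : ttriple R m) : R := t.1.1.
Definition tmu (R : realType) (m : nat) (t : ttriple R m) : 'rV[R]_m := t.1.2.
Definition tnu (R : realType) (m : nat) (t : ttriple R m) : R := t.2.

(* Inverse of the conformal metric, A being the components of a metric of the
   class and density1 A ^+ 2 *: A those of the conformal metric. *)
Definition conf_inv (R : realType) (m : nat) (A : 'M[R]_m) : 'M[R]_m :=
  invmx (density1 A ^+ 2 *: A).

(* Chart change: with J the Jacobian from chart a to chart b, an m-form has
   component in a equal to \det J times that in b, a density of weight w has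
   |det J|^(-w/m) as corresponding factor; the three slots have weights
   1, 1, -1. *)
Definition chart_change (R : realType) (m : nat) (J : 'M[R]_m)
    (t : ttriple R m) : ttriple R m :=
  ((\det J * `|\det J| `^ (- m%:R^-1) * tsig t : R^o),
   (\det J * `|\det J| `^ (- m%:R^-1)) *: (tmu t *m J^T),
   (\det J * `|\det J| `^ (m%:R^-1) * tnu t : R^o)).

(* Change of splitting from gam (with components A) to e^(2f) gam, Ups = df. *)
Definition splitting_change (R : realType) (m : nat) (A : 'M[R]_m)
    (Ups : 'rV[R]_m) (t : ttriple R m) : ttriple R m :=
  ((tsig t : R^o),
   tmu t + tsig t *: Ups,
   (tnu t - ((Ups *m conf_inv A *m (tmu t)^T) ord0 ord0
     + 2^-1 * (Ups *m conf_inv A *m Ups^T) ord0 ord0 * tsig t) : R^o)).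

Definition dbd (R : realType) (m : nat) (M : obmanifold R m) (a : chart M)
    (f : M -> R) (p : M) : 'rV[R]_m :=
  \row_i 'D_(@ebase R m i) (f \o bpnt a) (bcrd a p).

(* Smooth m-forms on the boundary with values in the standard tractor bundle
   of the conformal structure C. *)
Definition is_tractor_form (R : realType) (m : nat) (M : obmanifold R m)
    (C : set (bcov2 M)) (s : tform M) : Prop :=
  [/\ forall a gam, C gam ->
        [/\ smooth_bd a (fun p => tsig (s a gam p)),
            forall i, smooth_bd a (fun p => tmu (s a gam p) ord0 i)
          & smooth_bd a (fun p => tnu (s a gam p))],
      forall a b gam p, C gam -> bd M p -> dom a p -> dom b p ->
        s a gam p = chart_change (bjac a b p) (s b gam p)
    & forall (gam gam' : bcov2 M) (f : M -> R), C gam -> C gam' ->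
        (forall a, smooth_bd a f) ->
        (forall a p, bd M p -> dom a p ->
           gam' a p = expR (2 * f p) *: gam a p) ->
        forall a p, bd M p -> dom a p ->
          s a gam' p = splitting_change (gam a p) (dbd a f p) (s a gam p)].

Definition tform_eq (R : realType) (m : nat) (M : obmanifold R m)
    (C : set (bcov2 M)) (s t : tform M) : Prop :=
  forall a gam p, C gam -> bd M p -> dom a p -> s a gam p = t a gam p.

(* mu_ij, mu and mu^0_ij in the interior, with h = g + rho^(n-2) mu_ij and
   n - 2 = m.-1. *)
Definition mu_ij (R : realType) (m : nat) (M : obmanifold R m)
    (rho : M -> R) (g h : cov2 M) (a : chart M) (q : M) : 'M[R]_m.+1 :=
  (rho q ^+ m.-1)^-1 *: (h a q - g a q).

Definition mu_tr (R : realType) (m : nat) (M : obmanifold R m)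
    (rho : M -> R) (g h : cov2 M) (a : chart M) (q : M) : R :=
  (rho q ^+ 2)^-1 * \tr (invmx (g a q) *m mu_ij rho g h a q).

Definition mu0_ij (R : realType) (m : nat) (M : obmanifold R m)
    (rho : M -> R) (g h : cov2 M) (a : chart M) (q : M) : 'M[R]_m.+1 :=
  mu_ij rho g h a q
  - ((m.+1)%:R^-1 * rho q ^+ 2 * mu_tr rho g h a q) *: g a q.

(* u tensor sigma_oo^-1 X^A tensor vol_oo, where X^A = (0,0,1) in every
   splitting. *)
Definition vol_sigma_X (R : realType) (m : nat) (A : 'M[R]_m) (u : R)
    : ttriple R m :=
  ((0 : R^o), (0 : 'rV[R]_m), (volform A * u * (density1 A)^-1 : R^o)).

(* In c1 and c2, rho p is the local defining function near p with respect to
   which the value at the boundary point p is computed. *)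
Definition c1 (R : realType) (m : nat) (M : obmanifold R m)
    (rho : M -> M -> R) (g h : cov2 M) : tform M := fun a _ p =>
  vol_sigma_X (gbar_oo (rho p) g a p)
    (((m.+1)%:R ^+ 2 - 1) / 2 * bval (mu_tr (rho p) g h a) p).

Definition c2 (R : realType) (m : nat) (M : obmanifold R m)
    (rho : M -> M -> R) (g h : cov2 M) : tform M := fun a _ p =>
  let ginv := invmx (gbar (rho p) g a p) in
  let drho := dcomp a (rho p) p in
  vol_sigma_X (gbar_oo (rho p) g a p)
    (- (drho *m ginv *m bval_mx (mu0_ij (rho p) g h a) p
          *m ginv *m drho^T) ord0 ord0).

Definition cocycle_c (R : realType) (m : nat) (M : obmanifold R m)
    (rho : M -> M -> R) (g h : cov2 M) : tform M := fun a gam p =>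
  (m.+1)%:R^-1 *: c1 rho g h a gam p + 2^-1 *: c2 rho g h a gam p.

Definition tform_opp (R : realType) (m : nat) (M : obmanifold R m)
    (s : tform M) : tform M := fun a gam p => - s a gam p.

Definition tform_add (R : realType) (m : nat) (M : obmanifold R m)
    (s t : tform M) : tform M := fun a gam p => s a gam p + t a gam p.

(* Main.v *)
(* In a chart the first coordinate x_0 is a local defining function, and any
   other one is rho = w x_0 with w > 0 along the boundary.  The weights of the
   ingredients of c are such that w cancels, so c can be computed in each chart
   with x_0: its only nonzero slot is nu_coef A U e_0, where A and U are the
   boundary values of x_0^2 g and of x_0^(2-n) (h - g).  It is linear in U, and
   A is the same for g and h, whence the cocycle property.  Along the boundary
   the Jacobian matrices of the chart changes are block triangular, which gives
   the covariance of c.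

   A diffeomorphism asymptotic to the identity of order n+1 reads
   Phi(x) = x + x_0^(n+1) xi(x) in a chart, so that x_0^(2-n) (Phi^* h - h) has
   the boundary value (n+1) (E + E^T) - 2 xi_0 A with E = dx_0 (x) A(xi, .).
   As A^{00} = 1 by the ALH condition, this contributes (n^2-1) xi_0 to the
   coefficient of c_1 and -2 (n^2-1)/n xi_0 to that of c_2, and these cancel in
   c = c_1/n + c_2/2. *)

Require Import Defs.
From mathcomp Require Import all_boot all_order all_algebra.
From mathcomp Require Import all_classical all_reals all_analysis.
From mathcomp Require Import ring lra.
Import Order.TTheory GRing.Theory Num.Theory.
Import numFieldNormedType.Exports.

Set Implicit Arguments.
Unset Strict Implicit.
Unset Printing Implicit Defensive.

Local Open Scope classical_set_scope.
Local Open Scope ring_scope.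

(** * Functions of class C^k *)

(** The order n+1 of Phi is critical: one differentiation of x_0^(n+1) xi leaves a term of order
    x_0^n in the Jacobian matrix, and x_0^2 h is bounded, so x_0^2 (Phi^* h - h) has exactly the
    order x_0^n that the relation on the class allows. The term -2 xi_0 A comes from comparing x_0^2
    with its pullback, whereas displacing the argument of x_0^2 h costs x_0^(n+1) and leaves no
    trace on the boundary. Three obstacles shape the proof. The metrics live in the interior only,
    so identities on the boundary are obtained as limits along the proper filter [near_inn p], and
    functions smooth up to the boundary are handled through extensions to full neighbourhoods
    ([smooth_near]). The atlas controls Jacobian determinants over interior points only, and a
    boundary point is one with x_0 = 0 in some chart; that this holds in every chart, and that the
    Jacobian matrices stay invertible on the boundary, has to be derived. The condition on Phi tests
    global functions only, whereas it is needed for coordinates; hence the bump functions. *)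

Lemma cvg_near_eq (T : Type) (U : topologicalType) (F : set_system T) (f g : T -> U)
    (l : U) : Filter F -> (\forall x \near F, f x = g x) ->
  f x @[x --> F] --> l -> g x @[x --> F] --> l.
Proof. by move=> FF fg; apply: cvg_trans; exact: near_eq_cvg. Qed.

(** The first-order expansion of f at x is also one of g, with the same linear part; [diff_unique]
    then identifies the two differentials. *)
Lemma near_eq_differentiable (R : numFieldType) (V W : normedModType R)
    (f g : V -> W) (x : V) :
  (\forall y \near x, f y = g y) -> differentiable f x -> differentiable g x.
Proof.
move=> fg df; have fgx := nbhs_singleton fg.
have sx : h + x @[h --> (0 : V)] --> x.
  by rewrite -[X in _ --> X](add0r x); apply: cvgD; [exact: cvg_id|exact: cvg_cst].
have [dfc dfE] := (diff_locallyP _ _).1 df.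
have E : g \o shift x = cst (g x) + 'd f x +o_ (nbhs (0 : V)) id.
  apply/eqaddoP => e e0; move: dfE => /eqaddoP /(_ e e0) dfe.
  near=> h.
  have -> : (g \o shift x - (cst (g x) + 'd f x)) h =
     (f \o shift x - (cst (f x) + 'd f x)) h.
    rewrite !fctE fgx; congr (_ - _); apply/esym.
    by near: h; exact: (sx _ fg).
  by near: h.
have dg := diff_unique dfc E.
by apply/diff_locallyP; rewrite dg.
Unshelve. all: by end_near. Qed.

Section smooth_calculus.
Variables (R : realType) (n : nat).
Implicit Types (U W : set 'rV[R]_n) (f g : 'rV[R]_n -> R) (k : nat).

Lemma nbhs_open_eq W f g x : open W -> W x -> (forall y, W y -> f y = g y) ->
  \forall y \near x, f y = g y.
Proof. by move=> oW Wx fg; apply: filterS fg _; exact: open_nbhs_nbhs. Qed.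

Lemma Ck_ext k W f g : open W -> (forall x, W x -> f x = g x) ->
  Ck k W f -> Ck k W g.
Proof.
elim: k f g => [|k IH] f g oW fg /=.
  move=> cf x Wx; have fgx := nbhs_open_eq oW Wx fg.
  have := cvg_near_eq (nbhs_filter x) fgx (cf x Wx).
  by rewrite fg.
move=> [df Df]; split=> [x Wx|v].
  apply: near_eq_differentiable (df x Wx); exact: nbhs_open_eq fg.
apply: IH (Df v) => // x Wx; apply: near_eq_derive; exact: nbhs_open_eq fg.
Qed.

Lemma Ck_subset k U W f : U `<=` W -> Ck k W f -> Ck k U f.
Proof.
elim: k f => [|k IH] f UW /=; first by move=> cf x /UW /cf.
by move=> [df Df]; split=> [x /UW /df //|v]; exact: IH.
Qed.

Lemma CkS k W f : Ck k.+1 W f -> Ck k W f.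
Proof.
elim: k f => [|k IH] f.
  by case=> df _ x Wx; apply/differentiable_continuous/df.
case=> df Df; split => // v; apply: IH; exact: Df.
Qed.

Lemma Ck_cst k W (c : R) : Ck k W (fun=> c).
Proof.
elim: k c => [|k IH] c /=; first by move=> x _; exact: cst_continuous.
split=> [x _|v]; first exact: (differentiable_cst (c : R^o) x).
by have -> : 'D_v (fun=> c) = fun=> 0 by apply/funext => x; exact: derive_cst.
Qed.

Lemma CkD k W f g : open W -> Ck k W f -> Ck k W g ->
  Ck k W (fun x => f x + g x).
Proof.
elim: k f g => [|k IH] f g oW /=.
  by move=> cf cg x Wx; apply: continuousD; [exact: cf|exact: cg].
move=> [df Df] [dg Dg]; split=> [x Wx|v].
  by apply: differentiableD; [exact: df|exact: dg].
apply: Ck_ext (IH _ _ oW (Df v) (Dg v)) => // x Wx.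
by rewrite -deriveD //; apply/diff_derivable; [exact: df|exact: dg].
Qed.

Lemma CkM k W f g : open W -> Ck k W f -> Ck k W g ->
  Ck k W (fun x => f x * g x).
Proof.
elim: k f g => [|k IH] f g oW /=.
  by move=> cf cg x Wx; apply: continuousM; [exact: cf|exact: cg].
move=> /[dup] /CkS cf [df Df] /[dup] /CkS cg [dg Dg]; split=> [x Wx|v].
  by apply: differentiableM; [exact: df|exact: dg].
apply: Ck_ext (CkD oW (IH _ _ oW cf (Dg v)) (IH _ _ oW cg (Df v))) => // x Wx.
by rewrite [RHS]deriveM //; apply/diff_derivable; [exact: df|exact: dg].
Qed.

Lemma Ck_sum k W (I : Type) (r : seq I) (P : pred I) (F : I -> 'rV[R]_n -> R) :
  open W -> (forall i, Ck k W (F i)) ->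
  Ck k W (fun x => \sum_(i <- r | P i) F i x).
Proof.
move=> oW FW; elim: r => [|i r IH].
  by apply: Ck_ext (Ck_cst k W 0) => // x _; rewrite big_nil.
case Pi : (P i).
  by apply: Ck_ext (CkD oW (FW i) IH) => // x _; rewrite big_cons Pi.
by apply: Ck_ext IH => // x _; rewrite big_cons Pi.
Qed.

Lemma Ck_prod k W (I : Type) (r : seq I) (P : pred I) (F : I -> 'rV[R]_n -> R) :
  open W -> (forall i, Ck k W (F i)) ->
  Ck k W (fun x => \prod_(i <- r | P i) F i x).
Proof.
move=> oW FW; elim: r => [|i r IH].
  by apply: Ck_ext (Ck_cst k W 1) => // x _; rewrite big_nil.
case Pi : (P i).
  by apply: Ck_ext (CkM oW (FW i) IH) => // x _; rewrite big_cons Pi.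
by apply: Ck_ext IH => // x _; rewrite big_cons Pi.
Qed.

Lemma Ck_coord k W j : Ck k W (fun x : 'rV[R]_n => x ord0 j).
Proof.
case: k => [|k] /=; first by move=> x _; exact: coord_continuous.
split=> [x _|v]; first exact: differentiable_coord.
suff -> : 'D_v (fun x : 'rV[R]_n => x ord0 j) = fun=> v ord0 j by exact: Ck_cst.
apply/funext => x; have <- : ('D_v id x) ord0 j = v ord0 j by rewrite derive_id.
by rewrite derive_mx ?mxE //; exact: derivable_id.
Qed.

(* Closing the family P under differentiation is what makes the induction on
   the order k go through. *)
Lemma Ck_comp1 (P : (R -> R) -> Prop) (D : set R) :
  (forall phi, P phi -> exists2 psi, P psi &
     forall t, D t -> is_derive t 1 phi (psi t)) ->
  forall k W f phi, open W -> (forall x, W x -> D (f x)) -> P phi ->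
    Ck k W f -> Ck k W (fun x => phi (f x)).
Proof.
move=> HP; elim=> [|k IH] W f phi oW fD Pphi.
  move=> cf x Wx; have [psi _ /(_ _ (fD x Wx)) [dphi _]] := HP _ Pphi.
  apply: continuous_comp; first exact: cf.
  by apply/differentiable_continuous/derivable1_diffP.
move=> /[dup] /CkS cf [df Df]; have [psi Ppsi dphi] := HP _ Pphi.
have dd x : W x -> differentiable phi (f x).
  by move=> Wx; apply/derivable1_diffP; have [] := dphi _ (fD x Wx).
split=> [x Wx|v]; first by apply: differentiable_comp; [exact: df|exact: dd].
apply: Ck_ext (CkM oW (IH _ _ _ oW fD Ppsi cf) (Df v)) => // x Wx.
have dfx := df x Wx; have ddx := dd x Wx.
rewrite [RHS]deriveE; last exact: (differentiable_comp dfx ddx).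
rewrite diff_comp //= !deriveE // diff1E // /= derive1E.
by have [_ ->] := dphi _ (fD x Wx); rewrite mulrC.
Qed.

End smooth_calculus.

(** * Calculus in several variables *)

Lemma mx_cvg (R : numFieldType) (k l : nat) (T : Type) (F : set_system T)
    (f : T -> 'M[R]_(k, l)) (L : 'M[R]_(k, l)) : Filter F ->
  (forall i j, f x i j @[x --> F] --> L i j) -> f x @[x --> F] --> L.
Proof.
move=> FF fL A [Q QL QA]; rewrite /= nbhs_simpl.
apply: (filterS (P := fun x => forall i j, Q i j (f x i j))).
  by move=> x Qx; apply: QA.
apply: filter_forall => i; apply: filter_forall => j.
exact: (fL i j _ (QL i j)).
Qed.

Lemma cvg_mx (R : numFieldType) (k l : nat) (T : Type) (F : set_system T)
    (f : T -> 'M[R]_(k, l)) (L : 'M[R]_(k, l)) i j : Filter F ->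
  f x @[x --> F] --> L -> f x i j @[x --> F] --> L i j.
Proof.
move=> FF fL.
exact: (@cvg_comp _ _ _ f (fun M : 'M[R]_(k, l) => M i j) F (nbhs L)
  (nbhs (L i j)) fL (@coord_continuous _ _ _ i j L)).
Qed.

Section several_variables.
Variable R : realType.

Lemma row_ebase (n : nat) (v : 'rV[R]_n) :
  v = \sum_j v ord0 j *: @ebase R n j.
Proof. by rewrite [LHS]row_sum_delta. Qed.

Lemma differentiable_row (V : normedModType R) (l : nat)
    (T : V -> 'rV[R]_l) x :
  (forall j, differentiable (fun y => T y ord0 j) x) -> differentiable T x.
Proof.
move=> dT; have -> : T = \sum_(j < l) (fun y => T y ord0 j *: @ebase R l j).
  by apply/funext => y; rewrite fct_sumE -row_ebase.
apply: differentiable_sum => j.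
exact: (@differentiableZl R V 'rV[R]_l _ (@ebase R l j) x (dT j)).
Qed.

Lemma derive_row_coord (V : normedModType R) (l : nat) (T : V -> 'rV[R]_l)
    x v j : differentiable T x ->
  ('D_v T x) ord0 j = 'D_v (fun y => T y ord0 j) x.
Proof. by move=> dT; rewrite derive_mx ?mxE //; exact: diff_derivable. Qed.

Lemma derive_linear (n : nat) (f : 'rV[R]_n -> R) x v : differentiable f x ->
  'D_v f x = \sum_j v ord0 j * 'D_(@ebase R n j) f x.
Proof.
move=> df; rewrite deriveE // {1}(row_ebase v) linear_sum /=.
by apply: eq_bigr => j _; rewrite linearZ /= deriveE.
Qed.

Lemma derive_chain (n l : nat) (f : 'rV[R]_l -> R) (T : 'rV[R]_n -> 'rV[R]_l)
    x v : differentiable T x -> differentiable f (T x) ->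
  'D_v (f \o T) x =
  \sum_j 'D_(@ebase R l j) f (T x) * 'D_v (fun y => T y ord0 j) x.
Proof.
move=> dT df; rewrite deriveE; last exact: differentiable_comp.
rewrite diff_comp //= -!deriveE // derive_linear //.
by apply: eq_bigr => j _; rewrite derive_row_coord // mulrC.
Qed.

Lemma jacobian_row (n l : nat) (T : 'rV[R]_n -> 'rV[R]_l) x i j :
  differentiable T x ->
  'J T x i j = 'D_(@ebase R n i) (fun y => T y ord0 j) x.
Proof. by move=> dT; rewrite -derive_row_coord // deriveE // !mxE. Qed.

(** The induction varies f and keeps T fixed: by the chain rule a derivative of f o T is a sum of
    products of (d_j f) o T, covered by the induction hypothesis, and derivatives of the components
    of T. *)
Lemma Ck_comp (n l k : nat) (W : set 'rV[R]_n) (W' : set 'rV[R]_l)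
    (f : 'rV[R]_l -> R) (T : 'rV[R]_n -> 'rV[R]_l) :
  open W -> (forall x, W x -> W' (T x)) ->
  (forall j, Ck k W (fun x => T x ord0 j)) -> Ck k W' f ->
  Ck k W (fun x => f (T x)).
Proof.
move=> oW; elim: k f => [|k IH] f TW CT.
  move=> cf x Wx; apply: continuous_comp (cf _ (TW _ Wx)).
  apply: (@mx_cvg R 1 l _ (nbhs x) T (T x) (nbhs_filter x)) => i j.
  by rewrite (ord1 i); exact: (CT j x Wx).
move=> [df Df]; have dT x : W x -> differentiable T x.
  by move=> Wx; apply: differentiable_row => j; exact: (CT j).1.
split=> [x Wx|v]; first exact: differentiable_comp (dT x Wx) (df _ (TW _ Wx)).
apply: (@Ck_ext R n k W (fun x => \sum_j 'D_(@ebase R l j) f (T x) *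
  'D_v (fun y => T y ord0 j) x)) => //.
  by move=> x Wx; rewrite -derive_chain //; [exact: dT|exact/df/TW].
apply: (@Ck_sum R n k W _ (index_enum 'I_l) predT) => // j.
have CDT := (CT j).2 v; apply: CkM => //.
by apply: (IH _ TW _ (Df _)) => j'; exact/CkS/CT.
Qed.

Lemma CkV (n k : nat) (W : set 'rV[R]_n) (f : 'rV[R]_n -> R) : open W ->
  (forall x, W x -> f x != 0) -> Ck k W f -> Ck k W (fun x => (f x)^-1).
Proof.
move=> oW f0 Cf.
(* The multiples of the powers t^-i contain 1/t and are closed under differentiation, as [Ck_comp1]
   requires. *)
pose P (phi : R -> R) := exists (c : R) (i : nat), phi = fun t => c * t ^- i.
have PP phi : P phi -> exists2 psi, P psi &
    forall t : R, t != 0 -> is_derive t 1 phi (psi t).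
  move=> [c [i ->]]; exists (fun t => - (c * i%:R) * t ^- i.+1).
    by exists (- (c * i%:R)), i.+1.
  move=> t t0; have ti0 : t ^+ i != 0 by rewrite expf_neq0.
  have h : is_derive t 1 (fun t : R => t ^- i) (- (i%:R * t ^- i.+1)).
    have dX : derivable (fun s : R => s ^+ i) t 1 by exact: exprn_derivable.
    have gen (F : R -> R) : F t != 0 -> derivable F t 1 ->
        is_derive t 1 (fun s => (F s)^-1) (- (F t) ^- 2 *: 'D_1 F t).
      by move=> F0 dF; split; [exact: derivableV|exact: deriveV].
    have {gen} [h1 h2] := gen (fun s => s ^+ i) ti0 dX.
    split => //; rewrite h2 exp_derive.
    rewrite /GRing.scale /=.
    case: i {dX ti0 h1 h2} => [|i]; first by rewrite !mul0r !(mulr0, oppr0).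
    by rewrite !exprS; field; rewrite expf_neq0 ?t0.
  apply: is_derive_eq; rewrite mulNr -mulrA -mulrN; reflexivity.
have Q : P (fun t => t^-1) by exists 1, 1%N; apply/funext => t; rewrite mul1r.
exact: (Ck_comp1 PP oW f0 Q Cf).
Qed.

Lemma Ck_powR (n k : nat) (W : set 'rV[R]_n) (f : 'rV[R]_n -> R) (r : R) :
    open W ->
  (forall x, W x -> 0 < f x) -> Ck k W f -> Ck k W (fun x => f x `^ r).
Proof.
move=> oW f0 Cf.
pose P (phi : R -> R) := exists c r : R, phi = fun t => c * t `^ r.
have PP phi : P phi -> exists2 psi, P psi &
    forall t : R, 0 < t -> is_derive t 1 phi (psi t).
  move=> [c [s ->]]; exists (fun t => (c * s) * t `^ (s - 1)).
    by exists (c * s), (s - 1).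
  move=> t t0; have := is_derive1_powR s t0 => h.
  by apply: is_derive_eq; rewrite -mulrA.
have Q : P (fun t => t `^ r) by exists 1, r; apply/funext => t; rewrite mul1r.
exact: (Ck_comp1 PP oW f0 Q Cf).
Qed.

End several_variables.

Lemma cvg_sumr (R : realType) (T : Type) (F : set_system T) (I : Type)
    (r : seq I) (P : pred I) (f : I -> T -> R) (a : I -> R) : Filter F ->
  (forall i, f i x @[x --> F] --> a i) ->
  \sum_(i <- r | P i) f i x @[x --> F] --> \sum_(i <- r | P i) a i.
Proof.
move=> FF fa; elim: r => [|i r IH].
  by rewrite big_nil; under eq_fun do rewrite big_nil; exact: cvg_cst.
rewrite big_cons; under eq_fun do rewrite big_cons.
by case: ifP => // _; exact: cvgD.
Qed.

Lemma cvg_prodr (R : realType) (T : Type) (F : set_system T) (I : Type)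
    (r : seq I) (P : pred I) (f : I -> T -> R) (a : I -> R) : Filter F ->
  (forall i, f i x @[x --> F] --> a i) ->
  \prod_(i <- r | P i) f i x @[x --> F] --> \prod_(i <- r | P i) a i.
Proof.
move=> FF fa; elim: r => [|i r IH].
  by rewrite big_nil; under eq_fun do rewrite big_nil; exact: cvg_cst.
rewrite big_cons; under eq_fun do rewrite big_cons.
by case: ifP => // _; exact: cvgM.
Qed.

(** * A mean value theorem along filters *)

Section mean_value.
Variable R : realType.

Lemma mean_value_segment (n : nat) (f : 'rV[R]_n -> R) (u w : 'rV[R]_n) :
  (forall t : R, t \in `[0, 1] -> differentiable f (u + t *: (w - u))) ->
  exists2 t : R, t \in `[0, 1] & f w - f u = 'D_(w - u) f (u + t *: (w - u)).
Proof.
move=> df; pose l (t : R) : 'rV[R]_n := u + t *: (w - u).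
have dl t : is_diff t l (fun h : R => h *: (w - u)).
  have -> : (fun h : R => h *: (w - u)) = 0 + (fun h : R => h *: (w - u)).
    by rewrite add0r.
  exact: is_diffD.
have dfl (t : R) : t \in `[0, 1] -> is_derive t 1 (f \o l) ('D_(w - u) f (l t)).
  move=> t01; have dft := df t t01.
  have dd : differentiable (f \o l) t by apply: differentiable_comp.
  split; first exact: diff_derivable.
  by rewrite deriveE // diff_comp // /= diff_val scale1r deriveE.
have [|t t01] := @MVT_segment R (f \o l) (fun t => 'D_(w - u) f (l t)) 0 1 ler01
  (fun t ht => dfl t (subset_itv_oo_cc ht)).
  apply: derivable_within_continuous => t ht; have [] := dfl t ht; exact.
rewrite /= /l scale0r addr0 scale1r subr0 mulr1 [u + (w - u)]addrC subrK => E.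
by exists t.
Qed.

(* The intermediate points of the mean value theorem are chosen along the
   filter, so that continuity of the derivative can be applied to them. *)
Lemma mean_value_cvg (n : nat) (T : Type) (G : set_system T)
    (W : set 'rV[R]_n) (f : 'rV[R]_n -> R) (u w : T -> 'rV[R]_n) x : Filter G ->
  open W -> W x -> (forall y, W y -> differentiable f y) ->
  u q @[q --> G] --> x -> w q @[q --> G] --> x ->
  exists2 c : T -> 'rV[R]_n, c q @[q --> G] --> x &
    \forall q \near G, f (w q) - f (u q) = 'D_(w q - u q) f (c q).
Proof.
move=> FG oW Wx df ux wx.
pose Q q := [set t : R | 0 <= t <= 1 /\
  f (w q) - f (u q) = 'D_(w q - u q) f (u q + t *: (w q - u q))].
(* Where [Q q] is empty, [t q] is the default value 0, which still lies in [0, 1]; so the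
   intermediate points are controlled for every q. *)
pose t q := xget 0 (Q q).
have t01 q : 0 <= t q <= 1.
  by rewrite /t; case: xgetP => [y _ []|_] //; rewrite lexx ler01.
exists (fun q => u q + t q *: (w q - u q)).
  rewrite -[X in _ --> X]addr0; apply: cvgD => //.
  apply/cvgr0Pnorm_lt => e e0.
  have : (w q - u q) @[q --> G] --> (0 : 'rV[R]_n).
    by rewrite -(subrr x); exact: cvgB.
  move=> /cvgr0Pnorm_lt /(_ e e0); apply: filterS => q; apply: le_lt_trans.
  have /andP[t0 t1] := t01 q.
  by rewrite normrZ ger0_norm // ler_piMl.
have /nbhs_ballP [d /= d0 dW] : nbhs x W by exact: open_nbhs_nbhs.
near=> q; suff : Q q !=set0.
  by move=> [s Qs]; have [] := @xgetPex _ 0 (Q q) (ex_intro _ s Qs).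
have [|s s01 E] := @mean_value_segment n f (u q) (w q); last first.
  by exists s; split => //; move: s01; rewrite in_itv.
move=> s; rewrite in_itv /= => /andP[s0 s1]; apply/df/dW.
rewrite -ball_normE /ball_ /=.
(* Convexity of the ball: the segment from u q to w q stays inside W. *)
have -> : x - (u q + s *: (w q - u q)) = (1 - s) *: (x - u q) + s *: (x - w q).
  by apply/rowP => i; rewrite !mxE; ring.
apply: le_lt_trans (ler_normD _ _) _; rewrite !normrZ.
have -> : d = (1 - s) * d + s * d by ring.
have a : `|x - u q| < d by near: q; exact: (cvgrPdist_lt _ _).1 ux _ d0.
have b : `|x - w q| < d by near: q; exact: (cvgrPdist_lt _ _).1 wx _ d0.
rewrite !ger0_norm ?subr_ge0 //.
(* The strict inequality is taken from the summand with factor s, so s = 0 is treated apart. *)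
have [->|sn0] := eqVneq s 0; first by rewrite subr0 !mul0r !addr0 !mul1r.
apply: ler_ltD; first by apply: ler_wpM2l; [rewrite subr_ge0|exact: ltW].
by rewrite ltr_pM2l // lt_neqAle eq_sym sn0.
Unshelve. all: by end_near. Qed.

End mean_value.

(** * The flat function exp(-1/t) *)

Section bump.
Variable R : realType.

(** The polynomial factor makes the family closed under differentiation, as [Ck_comp1] requires; the
    standard flat function is [expinv 1]. *)
Definition expinv (p : {poly R}) (t : R) : R :=
  if 0 < t then p.[t^-1] * expR (- t^-1) else 0.

(** With s = 1/t, the bound exp(s) >= 1 + s^(i+1)/(i+1)! gives s^i exp(-s) <= (i+1)! t, monomial by
    monomial. *)
Lemma expinv_cvg0 (p : {poly R}) : expinv p t @[t --> (0 : R)] --> (0 : R).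
Proof.
have mono i : \forall t \near (0 : R), 0 < t ->
    `|t^-1 ^+ i * expR (- t^-1)| <= i.+1`!%:R * t.
  near=> t => t0; rewrite ger0_norm; last first.
    by rewrite mulr_ge0 ?exprn_ge0 ?invr_ge0 ?ltW // expR_gt0.
  have s0 : 0 < t^-1 by rewrite invr_gt0.
  have := @expR_ge1Dxn R t^-1 i (ltW s0); rewrite expRN => le.
  rewrite ler_pdivrMr ?expR_gt0 //.
  have {le} : t^-1 ^+ i.+1 / i.+1`!%:R <= expR t^-1 by lra.
  rewrite ler_pdivrMr ?ltr0n ?fact_gt0 // exprS => le.
  have := ler_wpM2l (ltW t0) le; rewrite mulVKf ?gt_eqF // => {}le.
  by apply: le_trans le _; rewrite mulrA [leLHS]mulrAC [t * _]mulrC.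
have mono0 i : (if 0 < t then t^-1 ^+ i * expR (- t^-1) else 0)
    @[t --> (0 : R)] --> (0 : R).
  apply/cvgr0Pnorm_lt => e e0; near=> t.
  case: ifPn => t0; last by rewrite normr0.
  apply: le_lt_trans (_ : i.+1`!%:R * t < e); first by move: t0; near: t; exact: mono.
  rewrite mulrC -ltr_pdivlMr ?ltr0n ?fact_gt0 //.
  apply: le_lt_trans (ler_norm _) _; near: t.
  by apply: (cvgr0Pnorm_lt _).1; [exact: cvg_id|rewrite divr_gt0 ?ltr0n ?fact_gt0].
have -> : expinv p = fun t => \sum_(i < size p)
    p`_i * (if 0 < t then t^-1 ^+ i * expR (- t^-1) else 0).
  apply/funext => t; rewrite /expinv; case: ifPn => _.
    by rewrite horner_coef mulr_suml; apply: eq_bigr => i _; rewrite mulrA.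
  by rewrite big1 // => i _; rewrite mulr0.
rewrite [X in _ --> X](_ : _ = \sum_(i < size p) p`_i * 0); last first.
  by rewrite big1 // => i _; rewrite mulr0.
by apply: cvg_sumr => i; apply: cvgM; [exact: cvg_cst|exact: mono0].
Unshelve. all: by end_near. Qed.

(** For t > 0 the derivative of p(1/t) exp(-1/t) is t^-2 (p - p')(1/t) exp(-1/t). At 0 the
    difference quotient is again a function of the family, for the polynomial p X, and tends to
    0. *)
Lemma is_derive_expinv (p : {poly R}) (t : R) :
  is_derive t 1 (expinv p) (expinv ('X^2 * (p - p^`())) t).
Proof.
have [t0|t0|->] := ltgtP t 0.
- rewrite /expinv ltNge ltW //=; apply: near_eq_is_derive (is_derive_cst 0 t 1).
  by near=> s; rewrite /cst ltNge ltW //=; near: s; exact: lt_nbhsl.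
- have tn0 : t != 0 by rewrite gt_eqF.
  have di : is_derive t 1 (fun s : R => s^-1) (- t ^- 2).
    split; first by apply: derivableV => //; exact: derivable_id.
    by rewrite (@deriveV _ _ (fun s => s) t 1) // ?derive_id /GRing.scale /= ?mulr1.
  have dN : is_derive t 1 (fun s : R => - s^-1) (t ^- 2).
    by apply: is_derive_eq; rewrite opprK.
  have d1 := is_derive1_comp (is_derive_poly p t^-1) di.
  have d2 := @is_derive1_comp R expR (fun s => - s^-1) t _ _
    (is_derive_expR (- t^-1)) dN.
  have d12 := is_deriveM d1 d2.
  apply: (@near_eq_is_derive R R R (fun s : R => p.[s^-1] * expR (- s^-1))).
    by near=> s; rewrite /expinv ifT //; near: s; exact: lt_nbhsr.
  apply: (is_derive_eq d12); rewrite /expinv t0 !hornerE /GRing.scale /=.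
  have aux (a b e s : R) : a * (e * s) + e * (b * - s) = s * (a - b) * e by ring.
  by rewrite -!exprVn; exact: aux.
- rewrite {2}/expinv ltxx.
  have E (h : R) : h^-1 * expinv p h = expinv (p * 'X) h.
    rewrite /expinv; case: ifP => _; last by rewrite mulr0.
    by rewrite hornerMX mulrCA mulrA.
  have c : h^-1 *: ((expinv p \o shift 0) (h *: 1) - expinv p 0)
      @[h --> (0 : R)^'] --> (0 : R).
    apply: (@cvg_near_eq _ _ _ (expinv (p * 'X))).
      near=> h; rewrite -E /= {3}/expinv ltxx subr0 addr0 /GRing.scale /=.
      by rewrite mulr1.
    by apply: cvg_within_filter; exact: expinv_cvg0.
  by split; [apply/cvg_ex; exists 0|exact: cvg_lim c].
Unshelve. all: by end_near. Qed.

Lemma Ck_expinv (n k : nat) (W : set 'rV[R]_n) (f : 'rV[R]_n -> R) (p : {poly R}) :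
  open W -> Ck k W f -> Ck k W (fun x => expinv p (f x)).
Proof.
move=> oW Cf; apply: (@Ck_comp1 R n (fun phi => exists p, phi = expinv p) setT) => //.
  move=> _ [q ->]; exists (expinv ('X^2 * (q - q^`()))); first by eexists.
  by move=> t _; exact: is_derive_expinv.
by exists p.
Qed.

Lemma expinv1_gt0 (t : R) : 0 < t -> 0 < expinv 1 t.
Proof. by move=> t0; rewrite /expinv t0 hornerE mul1r expR_gt0. Qed.

Lemma expinv_le0 (p : {poly R}) (t : R) : t <= 0 -> expinv p t = 0.
Proof. by move=> t0; rewrite /expinv ltNge t0. Qed.

End bump.

(** * The coefficient of the cocycle *)

Definition tail_mx (R : Type) (m : nat) (A : 'M[R]_m.+1) : 'M[R]_m :=
  \matrix_(i, j) A (lift ord0 i) (lift ord0 j).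

Section linear_algebra.
Variable R : realType.

(** The determinant of t A + (1 - t) I is a polynomial in t equal to 1 at t = 0. It has no zero on
    [0, 1], where the matrix remains positive definite, so the intermediate value theorem keeps it
    positive up to t = 1. *)
Lemma posdef_det_gt0 (k : nat) (A : 'M[R]_k) : sym_posdef A -> 0 < \det A.
Proof.
move=> [_ posA].
pose P : {poly R} := \det ('X *: map_mx polyC A + (1 - 'X)%:M).
have PE t : P.[t] = \det (t *: A + (1 - t)%:M).
  rewrite -horner_evalE -det_map_mx; congr (\det _); apply/matrixP => i j.
  by rewrite !mxE /= !(horner_evalE, hornerE) hornerMn !hornerE.
have P0 : P.[0] = 1 by rewrite PE scale0r add0r subr0 det1.
have P1 : P.[1] = \det A by rewrite PE scale1r subrr raddf0 addr0.
rewrite ltNge -P1; apply/negP => Ple0.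
have [|t /andP[t0 t1]] := @poly_ivt R (- P) 0 1 ler01.
  by rewrite !hornerN P0 oppr_le0 ler01 oppr_ge0.
rewrite rootE hornerN oppr_eq0 PE => /det0P [v v0].
rewrite mulmxDr -scalemxAr mul_mx_scalar => /(congr1 (mulmx^~ v^T)).
rewrite mul0mx mulmxDl -!scalemxAl => /matrixP /(_ ord0 ord0).
rewrite !mxE; set q := \sum_j _; set s := \sum_j _ => E.
have q0 : 0 < (v *m A *m v^T) ord0 ord0 by exact: posA.
have s0 : 0 < (v *m v^T) ord0 ord0.
  rewrite mxE lt_neqAle sumr_ge0; last by move=> j _; rewrite mxE -expr2 sqr_ge0.
  rewrite andbT eq_sym; apply: contra v0; rewrite psumr_eq0; last first.
    by move=> j _; rewrite mxE -expr2 sqr_ge0.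
  move=> /allP v0; apply/eqP/rowP => j; apply/eqP; rewrite mxE.
  by have := v0 j (mem_index_enum _); rewrite /= mxE mulf_eq0 orbb.
move: q0 s0; rewrite !mxE -/q -/s => q0 s0.
have [tz|tn] := eqVneq t 0.
  by move: E; rewrite tz mul0r add0r subr0 mul1r => s0'; rewrite s0' ltxx in s0.
have : 0 < t * q + (1 - t) * s.
  have tp : 0 < t by rewrite lt_neqAle eq_sym tn.
  by apply: ltr_wpDr; rewrite ?mulr_ge0 ?mulr_gt0 ?subr_ge0 // ltW.
by rewrite E ltxx.
Qed.

(** By the cofactor formula the entry (0, 0) of the inverse is the quotient of the two
    determinants. *)
Lemma tail_mx_det (m : nat) (A : 'M[R]_m.+1) : A \in unitmx ->
  invmx A ord0 ord0 = 1 -> \det (tail_mx A) = \det A.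
Proof.
move=> Au; rewrite /invmx Au !mxE /cofactor addn0 expr0 mul1r.
have -> : row' ord0 (col' ord0 A) = tail_mx A by apply/matrixP => i j; rewrite !mxE.
have d0 : \det A != 0 by rewrite unitmxE unitfE in Au.
by move=> /(canRL (mulKf _)) -> //; rewrite ?invr_eq0 // invrK mulr1.
Qed.

End linear_algebra.

(* The coefficient of the nu slot of the cocycle, as a function of the
   boundary values A, U and d of rho^2 g, mu_ij and d rho. *)
Definition nu_coef (R : realType) (m : nat) (A U : 'M[R]_m.+1) (d : 'rV[R]_m.+1)
    : R :=
  let u := \tr (invmx A *m U) in
  let B := U - ((m.+1)%:R^-1 * u) *: A in
  volform (tail_mx A) * (density1 (tail_mx A))^-1 *
  ((m.+1)%:R^-1 * (((m.+1)%:R ^+ 2 - 1) / 2 * u)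
   - 2^-1 * (d *m invmx A *m B *m invmx A *m d^T) ord0 ord0).

Section nu_coef_theory.
Variables (R : realType) (m : nat).
Implicit Types (A U : 'M[R]_m.+1) (d : 'rV[R]_m.+1).

Lemma nu_coefD A U V d : nu_coef A (U + V) d = nu_coef A U d + nu_coef A V d.
Proof.
rewrite /nu_coef mulmxDr mxtraceD; set u := \tr _; set v := \tr _.
have -> : U + V - ((m.+1)%:R^-1 * (u + v)) *: A =
  (U - ((m.+1)%:R^-1 * u) *: A) + (V - ((m.+1)%:R^-1 * v) *: A).
  by rewrite mulrDr scalerDl opprD addrACA.
by rewrite mulmxDr !mulmxDl [X in _ * (_ - _ * X)]mxE; ring.
Qed.

Lemma nu_coefN A U d : nu_coef A (- U) d = - nu_coef A U d.
Proof.
apply/eqP; rewrite -addr_eq0 -nu_coefD addNr /nu_coef !mulmx0 mxtrace0.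
by rewrite !mulr0 scale0r subr0 mulmx0 !mul0mx mxE mulr0 subr0 mulr0.
Qed.

Lemma volform_scale (A : 'M[R]_m) (w : R) : 0 < w ->
  volform (w ^+ 2 *: A) = w ^+ m * volform A.
Proof.
move=> w0; rewrite /volform detZ exprAC sqrtrM ?sqr_ge0 //.
by rewrite sqrtr_sqr ger0_norm // exprn_ge0 // ltW.
Qed.

Lemma density1_scale (A : 'M[R]_m) (w : R) : (0 < m)%N -> 0 < w ->
  0 <= \det A -> density1 (w ^+ 2 *: A) = w^-1 * density1 A.
Proof.
move=> m0 w0 A0; rewrite /density1 detZ powRM ?exprn_ge0 ?sqr_ge0 //.
rewrite -exprM -powR_mulrn ?ltW // -powRrM mulrN mul2n mulfV
  ?pnatr_eq0 ?double_eq0 -?lt0n //.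
  by rewrite powR_inv1 ?ltW.
exact: ltW.
Qed.

(** This is the independence of rho, for rho asymptotic to w x_0. The volume form contributes w^m
    and the inverse density w; in the bracket both the trace and the quadratic form contribute
    w^-(m+1). *)
Lemma nu_coef_scale A U d (w : R) : (0 < m)%N -> 0 < w -> A \in unitmx ->
  0 < \det (tail_mx A) ->
  nu_coef (w ^+ 2 *: A) ((w ^+ m.-1)^-1 *: U) (w *: d) = nu_coef A U d.
Proof.
move=> m0 w0 Au A0; have wn0 : w != 0 by rewrite gt_eqF.
have w2u : w ^+ 2 \is a GRing.unit by rewrite unitfE expf_neq0.
rewrite /nu_coef invmxZ ?unitmxZ //.
have -> : tail_mx (w ^+ 2 *: A) = w ^+ 2 *: tail_mx A.
  by apply/matrixP => i j; rewrite !mxE.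
rewrite volform_scale // density1_scale // ?(ltW A0) // -!scalemxAl -!scalemxAr.
rewrite !mxtraceZ [(w *: d)^T]linearZ /=; set u := \tr _.
have -> : (w ^+ m.-1)^-1 *: U
    - ((m.+1)%:R^-1 * ((w ^+ 2)^-1 * ((w ^+ m.-1)^-1 * u))) *: (w ^+ 2 *: A)
  = (w ^+ m.-1)^-1 *: (U - ((m.+1)%:R^-1 * u) *: A).
  rewrite scalerBr !scalerA; congr (_ - _ *: _); field.
  by rewrite expf_neq0 //= wn0 nat1r pnatr_eq0.
rewrite -!(scalemxAl, scalemxAr) !mxE.
set Q := (\sum_j _); set V := volform _; set D := density1 _.
have -> : w ^+ m = w * w ^+ m.-1 by rewrite -exprS prednK.
have D0 : D != 0 by rewrite gt_eqF // powR_gt0.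
have := expf_neq0 m.-1 wn0; move: (w ^+ m.-1) => z z0.
field; by rewrite nat1r pnatr_eq0 wn0 z0 D0.
Qed.

(** T stands for the Jacobian matrix of a chart change at a boundary point. The trace and the
    quadratic form are invariant under the congruence; block triangularity makes [tail_mx]
    compatible with it, and the volume form and the density then produce the factor of the nu slot
    in [chart_change]. *)
Lemma nu_coef_congr A U d (T : 'M[R]_m.+1) : (0 < m)%N -> A \in unitmx ->
  T \in unitmx -> 0 < \det (tail_mx T) -> 0 < \det (tail_mx A) ->
  (forall i, T (lift ord0 i) ord0 = 0) ->
  nu_coef (T *m A *m T^T) (T *m U *m T^T) (d *m T^T) =
  \det (tail_mx T) * `|\det (tail_mx T)| `^ (m%:R^-1) * nu_coef A U d.
Proof.
move=> m0 Au Tu T0 A0 Tl.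
have TTu : T^T \in unitmx by rewrite unitmx_tr.
have TAu : T *m A *m T^T \in unitmx by rewrite !unitmx_mul Tu Au TTu.
have iT : invmx (T *m A *m T^T) = invmx T^T *m invmx A *m invmx T.
  apply: (can_inj (mulKmx TAu)); rewrite mulmxV //.
  by rewrite -!mulmxA (mulKVmx TTu) (mulKVmx Au) mulmxV.
have tT : tail_mx (T *m A *m T^T) = tail_mx T *m tail_mx A *m (tail_mx T)^T.
  apply/matrixP => i j; rewrite !mxE big_ord_recl !mxE Tl mulr0 add0r.
  apply: eq_bigr => k _; rewrite !mxE big_ord_recl Tl mul0r add0r; congr (_ * _).
  by apply: eq_bigr => l _; rewrite !mxE.
have dtT : \det (tail_mx (T *m A *m T^T)) = \det (tail_mx T) ^+ 2 * \det (tail_mx A).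
  by rewrite tT !det_mulmx det_tr; ring.
rewrite /nu_coef iT.
have -> : \tr (invmx T^T *m invmx A *m invmx T *m (T *m U *m T^T)) = \tr (invmx A *m U).
  rewrite mxtrace_mulC !mulmxA (mulmxK TTu) mxtrace_mulC !mulmxA.
  by rewrite mulVmx // mul1mx mxtrace_mulC.
set u := \tr _; set B := U - _.
have -> : T *m U *m T^T - ((m.+1)%:R^-1 * u) *: (T *m A *m T^T) = T *m B *m T^T.
  by rewrite /B mulmxBr mulmxBl -scalemxAr -scalemxAl.
have -> : d *m T^T *m (invmx T^T *m invmx A *m invmx T) *m (T *m B *m T^T) *m
    (invmx T^T *m invmx A *m invmx T) *m (d *m T^T)^T
  = d *m invmx A *m B *m invmx A *m d^T.
  rewrite trmx_mul trmxK !mulmxA mulmxK // mulmxKV // mulmxK //.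
  by rewrite mulmxKV.
rewrite [RHS]mulrA; congr (_ * _); rewrite /volform /density1 dtT.
set t := \det (tail_mx T) in T0 *; set a := \det _.
rewrite sqrtrM ?sqr_ge0 // sqrtr_sqr powRM ?sqr_ge0 ?(ltW A0) // (gtr0_norm T0).
rewrite -[t ^+ 2]powR_mulrn ?(ltW T0) // -powRrM invfM.
have -> : (t `^ (2 * - (m.*2)%:R^-1))^-1 = t `^ m%:R^-1.
  rewrite -powRN; congr (_ `^ _); rewrite -mul2n natrM; field.
  by rewrite pnatr_eq0 -lt0n.
by move: (_ `^ _) (_ ^-1) (Num.sqrt _) => x y z; ring.
Qed.

(* The infinitesimal action of a vector field of order n + 1 along the boundary,
   with leading coefficient xi, does not change the cocycle. *)
Lemma nu_coef_vector_field A (xi : 'rV[R]_m.+1) : A \in unitmx -> A^T = A ->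
  invmx A ord0 ord0 = 1 ->
  let E := ((@ebase R m.+1 ord0)^T *m xi *m A) in
  nu_coef A ((m.+2)%:R *: (E + E^T) - (2 * xi ord0 ord0) *: A)
    (@ebase R m.+1 ord0) = 0.
Proof.
move=> Au As A1 E; set e := @ebase R m.+1 ord0.
have ET : E^T = A *m xi^T *m e by rewrite /E !trmx_mul trmxK As mulmxA.
have mx11 (B : 'M[R]_1) : \tr B = B ord0 ord0 by rewrite /mxtrace big_ord1.
have xie : (xi *m e^T) ord0 ord0 = xi ord0 ord0.
  rewrite mxE (bigD1 ord0) //= !mxE !eqxx mulr1 big1 ?addr0 // => i i0.
  by rewrite !mxE (negPf i0) mulr0.
have exi : (e *m xi^T) ord0 ord0 = xi ord0 ord0.
  by rewrite -[e]trmxK -trmx_mul mxE xie.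
have eAe : (e *m invmx A *m e^T) ord0 ord0 = 1.
  by rewrite -rowE mxE (bigD1 ord0) //= big1 ?addr0 ?mxE ?eqxx ?mulr1 //
    => i i0; rewrite !mxE (negPf i0) mulr0.
have trE : \tr (invmx A *m E) = xi ord0 ord0.
  by rewrite /E mulmxA mxtrace_mulC mulmxA mulmxV // mul1mx mxtrace_mulC mx11 xie.
have trET : \tr (invmx A *m E^T) = xi ord0 ord0.
  by rewrite ET !mulmxA mulVmx // mul1mx mxtrace_mulC mx11 exi.
have qE : (e *m invmx A *m E *m invmx A *m e^T) ord0 ord0 = xi ord0 ord0.
  rewrite /E -!mulmxA (mulmxA A) mulmxV // mul1mx !mulmxA.
  by rewrite -[_ *m xi *m _]mulmxA mxE big_ord1 eAe xie mul1r.
have qET : (e *m invmx A *m E^T *m invmx A *m e^T) ord0 ord0 = xi ord0 ord0.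
  rewrite ET !mulmxA mulmxKV // -[_ *m e *m _ *m _]mulmxA -[_ *m e *m _]mulmxA.
  by rewrite mxE big_ord1 mulmxA eAe exi mulr1.
have qA : (e *m invmx A *m A *m invmx A *m e^T) ord0 ord0 = 1.
  by rewrite mulmxKV.
rewrite /nu_coef.
(* With n = m+1 this is 2 (n+1) xi_0 - 2 n xi_0, the trace of the identity being n. *)
have -> : \tr (invmx A *m ((m.+2)%:R *: (E + E^T) - (2 * xi ord0 ord0) *: A)) =
   2 * xi ord0 ord0.
  rewrite mulmxBr -!scalemxAr mulmxDr linearB /= !mxtraceZ mxtraceD trE trET.
  rewrite mulVmx // mxtrace1 -(addn2 m) -addn1 !natrD; ring.
set c := _^-1 * (2 * _).
pose Q (M : 'M[R]_m.+1) := (e *m invmx A *m M *m invmx A *m e^T) ord0 ord0.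
have QD M N : Q (M + N) = Q M + Q N.
  by rewrite /Q mulmxDr !mulmxDl [LHS]mxE.
have QZ a M : Q (a *: M) = a * Q M.
  by rewrite /Q -scalemxAr -!scalemxAl [LHS]mxE.
have QN M : Q (- M) = - Q M by rewrite -scaleN1r QZ mulN1r.
(* The quadratic form is 2 (n+1) xi_0 - 2 xi_0 - (2/n) xi_0 = 2 (n - 1/n) xi_0; its half equals the
   trace term (n - 1/n) xi_0. *)
rewrite -/(Q _) !(QD, QN, QZ) {1}/Q qE {1}/Q qET {1}/Q qA {1}/Q qA /c.
move: (xi ord0 ord0) => x; rewrite -[m.+2%:R]natr1.
have : m.+1%:R != 0 :> R by rewrite pnatr_eq0.
move: (m.+1%:R) => z z0; rewrite [X in _ * X = _](_ : _ = 0) ?mulr0 //.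
by field.
Qed.

End nu_coef_theory.

(** * Limits of matrices and germs of smooth functions *)

Section matrix_limits.
Variables (R : realType) (T : Type) (F : set_system T).
Context {FF : Filter F}.

Lemma cvg_mulmx (k l n : nat) (f : T -> 'M[R]_(k, l)) (g : T -> 'M[R]_(l, n))
    (A : 'M[R]_(k, l)) (B : 'M[R]_(l, n)) :
  f x @[x --> F] --> A -> g x @[x --> F] --> B ->
  (f x *m g x) @[x --> F] --> A *m B.
Proof.
move=> fA gB; apply: mx_cvg => i j; under eq_fun do rewrite mxE.
by rewrite mxE; apply: cvg_sumr => s; apply: cvgM; exact: cvg_mx.
Qed.

Lemma cvg_trmx (k l : nat) (f : T -> 'M[R]_(k, l)) (A : 'M[R]_(k, l)) :
  f x @[x --> F] --> A -> (f x)^T @[x --> F] --> A^T.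
Proof.
move=> fA; apply: mx_cvg => i j; under eq_fun do rewrite mxE.
by rewrite mxE; exact: cvg_mx.
Qed.

Lemma cvg_scalemx (k l : nat) (c : T -> R) (f : T -> 'M[R]_(k, l)) (d : R)
    (A : 'M[R]_(k, l)) :
  c x @[x --> F] --> d -> f x @[x --> F] --> A ->
  (c x *: f x) @[x --> F] --> d *: A.
Proof.
move=> cd fA; apply: mx_cvg => i j; under eq_fun do rewrite mxE.
by rewrite mxE; apply: cvgM => //; exact: cvg_mx.
Qed.

Lemma cvg_addmx (k l : nat) (f g : T -> 'M[R]_(k, l)) (A B : 'M[R]_(k, l)) :
  f x @[x --> F] --> A -> g x @[x --> F] --> B ->
  (f x + g x) @[x --> F] --> A + B.
Proof. by move=> fA gB; apply: cvgD. Qed.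

Lemma cvg_mxtrace (k : nat) (f : T -> 'M[R]_k) (A : 'M[R]_k) :
  f x @[x --> F] --> A -> \tr (f x) @[x --> F] --> \tr A.
Proof. by move=> fA; apply: cvg_sumr => i; exact: cvg_mx. Qed.

Lemma cvg_det (k : nat) (f : T -> 'M[R]_k) (A : 'M[R]_k) :
  f x @[x --> F] --> A -> \det (f x) @[x --> F] --> \det A.
Proof.
move=> fA; apply: cvg_sumr => s; apply: cvgM; first exact: cvg_cst.
by apply: cvg_prodr => i; exact: cvg_mx.
Qed.

Lemma cvg_unitmx (k : nat) (f : T -> 'M[R]_k) (A : 'M[R]_k) :
  f x @[x --> F] --> A -> A \in unitmx -> \forall x \near F, f x \in unitmx.
Proof.
move=> fA Au; have d0 : \det A != 0 by rewrite unitmxE unitfE in Au.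
near=> x; rewrite unitmxE unitfE; near: x.
exact: (cvg_det fA (open_nbhs_nbhs (conj (@open_neq R 0) d0))).
Unshelve. all: by end_near. Qed.

Lemma cvg_invmx (k : nat) (f : T -> 'M[R]_k) (A : 'M[R]_k) :
  f x @[x --> F] --> A -> A \in unitmx ->
  invmx (f x) @[x --> F] --> invmx A.
Proof.
move=> fA Au; have fu := cvg_unitmx fA Au.
have d0 : \det A != 0 by rewrite unitmxE unitfE in Au.
(* [invmx] is the adjugate over the determinant only on invertible matrices, hence the eventual
   equality. *)
apply: (@cvg_near_eq _ _ _ (fun x => (\det (f x))^-1 *: \adj (f x))).
  by near=> x; rewrite /invmx ifT //; near: x.
rewrite /invmx Au; apply: cvg_scalemx; first by apply: cvgV => //; exact: cvg_det.
apply: mx_cvg => i j; under eq_fun do rewrite mxE.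
rewrite mxE; apply: cvgM; first exact: cvg_cst.
apply: cvg_det; apply: mx_cvg => s t; under eq_fun do rewrite !mxE.
by rewrite !mxE; exact: cvg_mx.
Unshelve. all: by end_near. Qed.

End matrix_limits.

Lemma near_open (T : topologicalType) (x : T) (P : T -> Prop) :
  (\forall y \near x, P y) -> exists V, [/\ open V, V x & forall y, V y -> P y].
Proof.
move=> nP; have : nbhs x P by exact: nP.
by rewrite nbhsE => -[V [oV Vx] VP]; exists V.
Qed.

Section smooth_near.
Variables (R : realType) (n : nat).

(** The neighbourhood W is a full one even when x lies on the boundary of the half-space, and it
    does not depend on k: f plays the role of a smooth extension across the boundary. *)
Definition smooth_near (x : 'rV[R]_n) (f : 'rV[R]_n -> R) : Prop :=
  exists W, [/\ open W, W x & forall k, Ck k W f].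

Implicit Types (x : 'rV[R]_n) (f g : 'rV[R]_n -> R).

Lemma smooth_near_cvg x f : smooth_near x f -> f y @[y --> x] --> f x.
Proof. by move=> [W [_ Wx Cf]]; exact: (Cf 0%N x Wx). Qed.

Lemma smooth_near_diff x f : smooth_near x f ->
  \forall y \near x, differentiable f y.
Proof.
move=> [W [oW Wx Cf]]; apply: filterS (open_nbhs_nbhs (conj oW Wx)) => y.
exact: (Cf 1%N).1.
Qed.

Lemma smooth_near_derive x f v : smooth_near x f -> smooth_near x ('D_v f).
Proof. by move=> [W [oW Wx Cf]]; exists W; split => // k; exact: (Cf k.+1).2. Qed.

Lemma smooth_near_cst x (c : R) : smooth_near x (fun=> c).
Proof. by exists setT; split => //; [exact: openT|move=> k; exact: Ck_cst]. Qed.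

Lemma smooth_near_coord x j : smooth_near x (fun y => y ord0 j).
Proof. by exists setT; split => //; [exact: openT|move=> k; exact: Ck_coord]. Qed.

Lemma smooth_nearD x f g : smooth_near x f -> smooth_near x g ->
  smooth_near x (fun y => f y + g y).
Proof.
move=> [W [oW Wx Cf]] [W' [oW' Wx' Cg]]; exists (W `&` W').
have oI := openI oW oW'; split => // k.
by apply: CkD => //; [apply: Ck_subset (Cf k)|apply: Ck_subset (Cg k)] => y [].
Qed.

Lemma smooth_nearM x f g : smooth_near x f -> smooth_near x g ->
  smooth_near x (fun y => f y * g y).
Proof.
move=> [W [oW Wx Cf]] [W' [oW' Wx' Cg]]; exists (W `&` W').
have oI := openI oW oW'; split => // k.
by apply: CkM => //; [apply: Ck_subset (Cf k)|apply: Ck_subset (Cg k)] => y [].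
Qed.

Lemma smooth_nearN x f : smooth_near x f -> smooth_near x (fun y => - f y).
Proof.
move=> /(smooth_nearM (smooth_near_cst x (-1))).
by under eq_fun do rewrite mulN1r.
Qed.

Lemma smooth_nearB x f g : smooth_near x f -> smooth_near x g ->
  smooth_near x (fun y => f y - g y).
Proof. by move=> sf /smooth_nearN; exact: smooth_nearD. Qed.

Lemma smooth_nearX x f k : smooth_near x f -> smooth_near x (fun y => f y ^+ k).
Proof.
move=> sf; elim: k => [|k IH]; first exact: smooth_near_cst.
by under eq_fun do rewrite exprS; exact: smooth_nearM.
Qed.

Lemma smooth_near_sum x (I : Type) (r : seq I) (P : pred I)
    (f : I -> 'rV[R]_n -> R) : (forall i, smooth_near x (f i)) ->
  smooth_near x (fun y => \sum_(i <- r | P i) f i y).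
Proof.
move=> sf; elim: r => [|i r IH].
  by under eq_fun do rewrite big_nil; exact: smooth_near_cst.
under eq_fun do rewrite big_cons.
by case: (P i) => //; exact: smooth_nearD.
Qed.

Lemma smooth_near_prod x (I : Type) (r : seq I) (P : pred I)
    (f : I -> 'rV[R]_n -> R) : (forall i, smooth_near x (f i)) ->
  smooth_near x (fun y => \prod_(i <- r | P i) f i y).
Proof.
move=> sf; elim: r => [|i r IH].
  by under eq_fun do rewrite big_nil; exact: smooth_near_cst.
under eq_fun do rewrite big_cons.
by case: (P i) => //; exact: smooth_nearM.
Qed.

Lemma smooth_near_open x f (D : set R) : open D -> smooth_near x f -> D (f x) ->
  exists W, [/\ open W, W x, forall k, Ck k W f & forall y, W y -> D (f y)].
Proof.
move=> oD /[dup] /smooth_near_cvg cf [W [oW Wx Cf]] Dfx.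
have /near_open [V [oV Vx VD]] : \forall y \near x, D (f y).
  by apply: cf; exact: open_nbhs_nbhs.
exists (W `&` V); split => //; first exact: openI.
- by move=> k; apply: Ck_subset (Cf k) => y [].
- by move=> y [_ /VD].
Qed.

Lemma smooth_nearV x f : smooth_near x f -> f x != 0 ->
  smooth_near x (fun y => (f y)^-1).
Proof.
move=> sf fx0; have [W [oW Wx Cf W0]] := smooth_near_open (@open_neq R 0) sf fx0.
by exists W; split => // k; exact: CkV.
Qed.

Lemma smooth_near_powR x f (r : R) : smooth_near x f -> 0 < f x ->
  smooth_near x (fun y => f y `^ r).
Proof.
move=> sf fx0; have [W [oW Wx Cf W0]] := smooth_near_open (@open_gt R 0) sf fx0.
by exists W; split => // k; exact: Ck_powR.
Qed.

Lemma smooth_near_det x (l : nat) (A : 'rV[R]_n -> 'M[R]_l) :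
  (forall i j, smooth_near x (fun y => A y i j)) ->
  smooth_near x (fun y => \det (A y)).
Proof.
move=> sA; apply: smooth_near_sum => s.
by apply: smooth_nearM; [exact: smooth_near_cst|exact: smooth_near_prod].
Qed.

Lemma smooth_near_ext x f g : (\forall y \near x, f y = g y) ->
  smooth_near x f -> smooth_near x g.
Proof.
move=> /near_open [V [oV Vx VE]] [W [oW Wx Cf]].
exists (W `&` V); have oI := openI oW oV; split => // k.
apply: (Ck_ext oI (f := f)); first by move=> y [_ /VE].
by apply: Ck_subset (Cf k) => y [].
Qed.

End smooth_near.

Lemma smooth_near_comp (R : realType) (n l : nat) (x : 'rV[R]_n)
    (T : 'rV[R]_n -> 'rV[R]_l) (f : 'rV[R]_l -> R) :
  (forall j, smooth_near x (fun y => T y ord0 j)) -> smooth_near (T x) f ->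
  smooth_near x (fun y => f (T y)).
Proof.
move=> sT [W' [oW' Wx' Cf]].
have cT : T y @[y --> x] --> T x.
  apply: (@mx_cvg R 1 l _ (nbhs x) T (T x) (nbhs_filter x)) => i j.
  by rewrite (ord1 i); exact: smooth_near_cvg.
have [W sTW] := choice sT.
have /near_open [V [oV Vx VW]] : \forall y \near x, W' (T y) /\ forall j, W j y.
  apply: (@filterI _ (nbhs x) (nbhs_filter x)).
    exact: (cT _ (open_nbhs_nbhs (conj oW' Wx'))).
  apply: (@filter_forall _ _ _ (nbhs x) (nbhs_filter x)) => j.
  by have [oW Wx _] := sTW j; exact: open_nbhs_nbhs.
exists V; split => // k.
apply: (Ck_comp oV (W' := W')) => //; first by move=> y /VW [].
by move=> j; have [_ _ CT] := sTW j; apply: Ck_subset (CT k) => y /VW [].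
Qed.

(** * Charts and the boundary *)

Section charts.
Variables (R : realType) (m : nat) (M : obmanifold R m).
Implicit Types (a b : chart M) (p q : M).

Local Notation ncrd a := (fun q : M => crd a q ord0 ord0).
Local Notation e0 := (@ebase R m.+1 ord0).

(** The filter along which [bval] takes its limits. *)
Definition near_inn (p : M) : set_system M := within (inn M) (nbhs p).

Global Instance near_inn_filter p : Filter (near_inn p).
Proof. exact: within_filter. Qed.

Lemma near_near_inn p (P : M -> Prop) :
  (\forall q \near p, P q) -> \forall q \near near_inn p, P q.
Proof. exact: cvg_within. Qed.

Lemma cvg_near_inn p (f : M -> R) (l : R) :
  f q @[q --> p] --> l -> f q @[q --> near_inn p] --> l.
Proof. by apply: cvg_trans; apply: cvg_app; exact: cvg_within. Qed.

Lemma near_inn_inn p : \forall q \near near_inn p, inn M q.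
Proof. exact: withinT. Qed.

Lemma dom_near a p : dom a p -> \forall q \near p, dom a q.
Proof. by move=> ap; apply: open_nbhs_nbhs; split => //; exact: dom_open. Qed.

Lemma crd_cvg a p : dom a p -> crd a q @[q --> p] --> crd a p.
Proof.
move=> ap; have := @crd_continuous _ _ M a.
rewrite continuous_open_subspace; last exact: dom_open.
by apply; rewrite inE.
Qed.

Lemma crd_ge0 a q : dom a q -> 0 <= ncrd a q.
Proof.
move=> aq; have [Z [_ E]] := @crd_image _ _ M a.
have : (crd a @` dom a) (crd a q) by exists q.
by rewrite E => -[].
Qed.

(** The image of a chart is only relatively open in the half-space and [pnt] is continuous only for
    the subspace topology, whence the condition on x_0. *)
Lemma pnt_near a p (V : set M) : dom a p -> nbhs p V ->
  \forall x \near crd a p, 0 <= (x : 'rV[R]_m.+1) ord0 ord0 ->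
    [/\ dom a (pnt a x), crd a (pnt a x) = x & V (pnt a x)].
Proof.
move=> ap Vp; have [Z [oZ E]] := @crd_image _ _ M a.
have hp : (crd a @` dom a) (crd a p) by exists p.
have Zp : Z (crd a p) by move: hp; rewrite E => -[].
have H : nbhs (crd a p : subspace (crd a @` dom a)) (pnt a @^-1` V).
  have c : pnt a x @[x --> (crd a p : subspace (crd a @` dom a))] -->
      pnt a (crd a p) by exact: pnt_continuous.
  by rewrite crdK // in c; exact: c.
rewrite /nbhs /= -nbhs_subspace_in // in H.
apply: filterS2 (open_nbhs_nbhs (conj oZ Zp)) H => x Zx Vx x0.
have [q aq qx] : (crd a @` dom a) x by rewrite E.
have Vx' : V (pnt a x) by apply: Vx; exists q.
by split => //; rewrite -qx crdK.
Qed.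

Lemma smooth_fn_germ a p (V : set M) f : open V -> V p -> dom a p ->
  smooth_fn V f -> exists2 F, smooth_near (crd a p) F &
    \forall q \near p, f q = F (crd a q).
Proof.
move=> oV Vp ap sf; have [|W [F [oW Wp CF fF]]] := sf a (crd a p); first by exists p.
exists F; first by exists W.
have nV : \forall q \near p, V q by exact: open_nbhs_nbhs.
have nW : \forall q \near p, W (crd a q).
  by apply: (crd_cvg ap); exact: open_nbhs_nbhs.
near=> q; have aq : dom a q by near: q; exact: dom_near.
rewrite -fF /= ?crdK //; first by near: q.
by exists q => //; split => //; near: q.
Unshelve. all: by end_near. Qed.

Lemma extends_germ a p (D : set M) f : dom a p -> extends D f p ->
  exists2 F, smooth_near (crd a p) F &
    \forall q \near p, D q -> f q = F (crd a q).
Proof.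
move=> ap [V [u [oV Vp su fu]]]; have [F sF uF] := smooth_fn_germ oV Vp ap su.
exists F => //; have nV : \forall q \near p, V q by exact: open_nbhs_nbhs.
by apply: filterS2 nV uF => q Vq <- Dq; exact: fu.
Qed.

Lemma germ_cvg a p (f : M -> R) F : dom a p -> smooth_near (crd a p) F ->
  (\forall q \near p, inn M q -> f q = F (crd a q)) ->
  f q @[q --> near_inn p] --> F (crd a p).
Proof.
move=> ap sF fF; apply: (@cvg_near_eq _ _ _ (fun q => F (crd a q))).
  near=> q; apply/esym; have : inn M q by near: q; exact: near_inn_inn.
  by near: q; exact: near_near_inn.
apply: cvg_near_inn.
exact: (@cvg_comp _ _ _ (crd a) F _ _ _ (crd_cvg ap) (smooth_near_cvg sF)).
Unshelve. all: by end_near. Qed.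

Lemma transition_germ a b p : dom a p -> dom b p ->
  exists2 S : 'rV[R]_m.+1 -> 'rV[R]_m.+1,
    (forall j, smooth_near (crd a p) (fun x => S x ord0 j)) &
    \forall q \near p, crd b q = S (crd a q).
Proof.
move=> ap bp; have sj j : exists F, smooth_near (crd a p) F /\
    \forall q \near p, crd b q ord0 j = F (crd a q).
  have [|W [F [oW Wp CF fF]]] := @transition_smooth _ _ M a b j (crd a p).
    by exists p.
  exists F; split; first by exists W.
  have nW : \forall q \near p, W (crd a q).
    by apply: (crd_cvg ap); exact: open_nbhs_nbhs.
  near=> q; have aq : dom a q by near: q; exact: dom_near.
  have bq : dom b q by near: q; exact: dom_near.
  by rewrite -fF ?crdK //; [near: q|exists q].
have [S sS] := choice sj; exists (fun x => \row_j S j x).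
  by move=> j; under eq_fun do rewrite mxE; exact: (sS j).1.
have : \forall q \near p, forall j, crd b q ord0 j = S j (crd a q).
  by apply: filter_forall => j; exact: (sS j).2.
by apply: filterS => q E; apply/rowP => j; rewrite mxE.
Unshelve. all: by end_near. Qed.

End charts.

(** * Invariance of the boundary under chart changes *)

Lemma derive_ge0 (R : realType) (V : normedModType R) (F : V -> R) x v :
  differentiable F x -> (\forall h \near (0 : R)^'+, F x <= F (h *: v + x)) ->
  0 <= 'D_v F x.
Proof.
move=> dF Fge; have dv : derivable F x v by exact: diff_derivable.
have c : h^-1 *: (F (h *: v + x) - F x) @[h --> (0 : R)^'+] --> 'D_v F x.
  exact: cvg_dnbhs_at_right dv.
rewrite -(cvg_lim _ c) //; apply: limr_ge; first by apply/cvg_ex; eexists; exact: c.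
near=> h; have h0 : 0 < h by near: h; exact: nbhs_right_gt.
apply: mulr_ge0; first by rewrite invr_ge0 ltW.
by rewrite subr_ge0; near: h.
Unshelve. all: by end_near. Qed.

Lemma derive_along (R : realType) (V : normedModType R) (F : V -> R) x v (c : R) :
  (\forall h \near (0 : R), F (h *: v + x) = c) -> 'D_v F x = 0.
Proof.
move=> Fc; have Fx : F x = c by have := nbhs_singleton Fc; rewrite scale0r add0r.
apply: cvg_lim => //; apply: (@cvg_near_eq _ _ _ (fun=> 0)); last exact: cvg_cst.
near=> h; rewrite /= (_ : F (h *: v + x) = c) ?Fx ?subrr ?scaler0 //.
by near: h; exact: nbhs_dnbhs.
Unshelve. all: by end_near. Qed.

Lemma ray_cvg (R : realType) (V : normedModType R) (x v : V) :
  (h *: v + x) @[h --> (0 : R)] --> x.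
Proof.
rewrite -[X in _ --> X]add0r -[X in X + _](scale0r v).
by apply: cvgD; [apply: cvgZr_tmp; exact: cvg_id|exact: cvg_cst].
Qed.

Section boundary.
Variables (R : realType) (m : nat) (M : obmanifold R m).
Implicit Types (a b : chart M) (p q : M).

Local Notation ncrd a := (fun q : M => crd a q ord0 ord0).
Local Notation e0 := (@ebase R m.+1 ord0).

Lemma jacobian_germ n k (f g : 'rV[R]_n -> 'rV[R]_k) x i j :
  (\forall y \near x, f y = g y) ->
  (forall j, differentiable (fun y => g y ord0 j) x) ->
  differentiable f x /\ 'J f x i j = 'D_(@ebase R n i) (fun y => g y ord0 j) x.
Proof.
move=> fg dg; have dgx : differentiable g x by exact: differentiable_row.
have df : differentiable f x.
  by apply: near_eq_differentiable dgx; apply: filterS fg => y ->.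
split => //; rewrite jacobian_row //; apply: near_eq_derive.
by apply: filterS fg => y ->.
Qed.

(** If another chart b had x_0 = 0 at p, the first component of the change from a to b would reach
    its minimum 0 at an interior point of the half-space. Its derivatives in the directions v and -v
    would be nonnegative, hence zero, and the Jacobian determinant would vanish, against
    [transition_oriented]. *)
Lemma crd_gt0_inn a p : dom a p -> 0 < ncrd a p -> inn M p.
Proof.
move=> ap p0 [b [bp bp0]]; have [S sS SE] := transition_germ ap bp.
have nS : \forall x \near crd a p, 0 <= S x ord0 ord0 /\ (crd b \o pnt a) x = S x.
  have nV : \forall q \near p, dom b q /\ crd b q = S (crd a q).
    by apply: filterI => //; exact: dom_near.
  have n0 : \forall x \near crd a p, 0 < (x : 'rV[R]_m.+1) ord0 ord0.
    exact: (@coord_continuous _ _ _ ord0 ord0 (crd a p) _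
      (open_nbhs_nbhs (conj (@open_gt R 0) p0))).
  apply: filterS2 (pnt_near ap nV) n0 => x H x0.
  have [ax xE [bx Sx]] := H (ltW x0).
  by rewrite /= Sx xE; split => //; rewrite -[x]xE -Sx; exact: crd_ge0.
have dS j : differentiable (fun y => S y ord0 j) (crd a p).
  exact: nbhs_singleton (smooth_near_diff (sS j)).
have Sp : S (crd a p) ord0 ord0 = 0.
  by rewrite -(nbhs_singleton SE).
have D_ge0 v : 0 <= 'D_v (fun y => S y ord0 ord0) (crd a p).
  apply: derive_ge0 => //.
  have : \forall h \near (0 : R), 0 <= S (h *: v + crd a p) ord0 ord0.
    have nS1 : nbhs (crd a p) [set x | 0 <= S x ord0 ord0].
      exact: (filterS (fun x => @proj1 _ _) nS).
    exact: (ray_cvg v nS1).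
  by rewrite Sp; exact: cvg_within.
have D0 v : 'D_v (fun y => S y ord0 ord0) (crd a p) = 0.
  apply/eqP; rewrite eq_le D_ge0 andbT -oppr_ge0.
  suff <- : 'D_(- v) (fun y => S y ord0 ord0) (crd a p) =
    - 'D_v (fun y => S y ord0 ord0) (crd a p) by [].
  by rewrite !deriveE // linearN.
have := transition_oriented ap bp p0; suff -> : \det ('J (crd b \o pnt a) (crd a p)) = 0.
  by rewrite ltxx.
rewrite (expand_det_col _ ord0) big1 // => i _.
have [_ ->] := @jacobian_germ _ _ (crd b \o pnt a) S (crd a p) i ord0
  (filterS (fun x => @proj2 _ _) nS) dS.
by rewrite D0 mul0r.
Qed.

Lemma bd_crd a p : dom a p -> bd M p <-> ncrd a p = 0.
Proof.
move=> ap; split=> [bp|p0]; last by exists a.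
apply/eqP; apply: contraT => pn0; have := @crd_gt0_inn a p ap.
by rewrite lt_neqAle eq_sym pn0 crd_ge0 // => /(_ isT) /(_ bp).
Qed.

Lemma inn_crd a p : dom a p -> inn M p -> 0 < ncrd a p.
Proof.
move=> ap ip; rewrite lt_neqAle crd_ge0 // andbT eq_sym; apply/eqP => p0.
by apply: ip; apply/(bd_crd ap).
Qed.

(** Over the interior the side condition of [pnt_near] disappears, since x_0 > 0 is an open
    condition; derivatives at crd a q may then be compared. *)
Lemma near_pull a q (P : M -> Prop) : dom a q -> inn M q ->
  (\forall r \near q, P r) ->
  \forall x \near crd a q, [/\ dom a (pnt a x), crd a (pnt a x) = x,
    inn M (pnt a x) & P (pnt a x)].
Proof.
move=> aq iq nP.
have n0 : \forall x \near crd a q, 0 < (x : 'rV[R]_m.+1) ord0 ord0.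
  exact: (@coord_continuous _ _ _ ord0 ord0 (crd a q) _
    (open_nbhs_nbhs (conj (@open_gt R 0) (inn_crd aq iq)))).
apply: filterS2 (pnt_near aq nP) n0 => x H x0.
have [ax xE Px] := H (ltW x0).
by split => //; apply: (crd_gt0_inn ax); rewrite xE.
Qed.

(** Moving from p by a small h > 0 in the direction of x_0 gives interior points arbitrarily close
    to p. Properness makes limits along [near_inn p] unique, which is how boundary values are
    identified below. *)
Lemma near_inn_proper p : bd M p -> ProperFilter (near_inn p).
Proof.
move=> bp; have ap := dom_chart_at p; set a := chart_at p in ap.
apply: Build_ProperFilter_ex => P; rewrite /near_inn => nP.
have p0 := (bd_crd ap).1 bp.
have nP1 : \forall h \near (0 : R)^'+, 0 <= (h *: e0 + crd a p) ord0 ord0 ->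
    [/\ dom a (pnt a (h *: e0 + crd a p)),
        crd a (pnt a (h *: e0 + crd a p)) = h *: e0 + crd a p &
        inn M (pnt a (h *: e0 + crd a p)) -> P (pnt a (h *: e0 + crd a p))].
  by apply: cvg_within; exact: (ray_cvg e0 (pnt_near ap nP)).
have nP2 := @filterI _ (0 : R)^'+ _ _ _ nP1 (nbhs_right_gt (0 : R)).
have [h [nPh h0]] := @filter_ex _ (0 : R)^'+ _ _ (nP2 _).
have hE : (h *: e0 + crd a p) ord0 ord0 = h.
  by rewrite !mxE !eqxx mulr1 p0 addr0.
have [|ah hc HP] := nPh; first by rewrite hE ltW.
by eexists; apply: HP; apply: (crd_gt0_inn ah); rewrite hc hE.
Qed.

End boundary.

(** * First derivatives at boundary points *)

Section boundary_jets.
Variables (R : realType) (m : nat) (M : obmanifold R m).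
Implicit Types (a b : chart M) (p q : M).

Local Notation ncrd a := (fun q : M => crd a q ord0 ord0).
Local Notation e0 := (@ebase R m.+1 ord0).

Lemma bval_cvg p (f : M -> R) (l : R) : bd M p ->
  f q @[q --> near_inn p] --> l -> bval f p = l.
Proof. by move=> bp fl; have ? := near_inn_proper bp; exact: cvg_lim fl. Qed.

Lemma bval_mx_cvg p k l (f : M -> 'M[R]_(k, l)) (A : 'M[R]_(k, l)) : bd M p ->
  f q @[q --> near_inn p] --> A -> bval_mx f p = A.
Proof.
by move=> bp fA; apply/matrixP => i j; rewrite mxE; apply: bval_cvg => //; exact: cvg_mx.
Qed.

(** Comparing derivatives at a point q close to p requires an identity on a neighbourhood of q, not
    just at q. *)
Lemma near_nested p (P : M -> Prop) : (\forall q \near p, P q) ->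
  \forall q \near p, \forall r \near q, P r.
Proof. by move=> nP; exact: (nbhs_interior (nP : nbhs p P)). Qed.

Lemma smooth_near_crd a p F : dom a p -> smooth_near (crd a p) F ->
  \forall q \near p, smooth_near (crd a q) F.
Proof.
move=> ap [W [oW Wp CF]]; have : \forall q \near p, W (crd a q).
  by apply: (crd_cvg ap); exact: open_nbhs_nbhs.
by apply: filterS => q Wq; exists W.
Qed.

Lemma dcomp_germ a p (f : M -> R) F : bd M p -> dom a p ->
  smooth_near (crd a p) F -> (\forall q \near p, f q = F (crd a q)) ->
  Defs.dcomp a f p = \row_i 'D_(@ebase R m.+1 i) F (crd a p).
Proof.
move=> bp ap sF fF; apply/rowP => i; rewrite !mxE; apply: bval_cvg => //.
apply: (@germ_cvg _ _ _ a p _ ('D_(@ebase R m.+1 i) F)) => //.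
  exact: smooth_near_derive.
near=> q => iq; have aq : dom a q by near: q; exact: dom_near.
apply: near_eq_derive; have : \forall r \near q, f r = F (crd a r).
  by near: q; exact: near_nested.
by move/(near_pull aq iq); apply: filterS => x [_ xE _] /= ->; rewrite xE.
Unshelve. all: by end_near. Qed.

(** A displacement in a tangential direction stays in x_0 = 0, where f vanishes, so F is constant
    along that line. *)
Lemma bd_tangential a p (f : M -> R) F i : bd M p -> dom a p ->
  (\forall q \near p, f q = F (crd a q)) -> (\forall q \near p, bd M q -> f q = 0) ->
  'D_(@ebase R m.+1 (lift ord0 i)) F (crd a p) = 0.
Proof.
move=> bp ap fF f0; apply: (@derive_along _ _ _ _ _ 0).
have H : \forall q \near p, f q = F (crd a q) /\ (bd M q -> f q = 0).
  exact: filterI.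
have nH : \forall h \near (0 : R), _ :=
  ray_cvg (@ebase R m.+1 (lift ord0 i)) (pnt_near ap H).
apply: filterS nH => h /=.
have -> : (h *: @ebase R m.+1 (lift ord0 i) + crd a p) ord0 ord0 = 0.
  by rewrite !mxE /= mulr0 add0r; exact/(bd_crd ap).
move=> /(_ (lexx 0)) [ah hE [fE f0h]].
rewrite -[X in F X]hE -fE; apply: f0h; apply/(bd_crd ah).
by rewrite hE !mxE /= mulr0 add0r; exact/(bd_crd ap).
Qed.

(** T consists of the first derivatives at p of a smooth extension S of the chart change. Its column
    0 is the differential of a function that vanishes on the boundary and is nonnegative, which
    gives the zeros and the sign of the corner. *)
Lemma transition_jacobian a b p : bd M p -> dom a p -> dom b p ->
  exists T : 'M[R]_m.+1, [/\
    'J (crd b \o pnt a) (crd a q) @[q --> near_inn p] --> T,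
    forall i, T (lift ord0 i) ord0 = 0, tail_mx T = bjac a b p, 0 <= T ord0 ord0 &
    forall j, Defs.dcomp a (fun q => crd b q ord0 j) p = \row_i T i j].
Proof.
move=> bp ap bbp; have [S sS SE] := transition_germ ap bbp.
pose T : 'M[R]_m.+1 := \matrix_(i, j) 'D_(@ebase R m.+1 i) (fun x => S x ord0 j) (crd a p).
have SEj j : \forall q \near p, crd b q ord0 j = S (crd a q) ord0 j.
  by apply: filterS SE => q ->.
have S0 : \forall q \near p, bd M q -> crd b q ord0 ord0 = 0.
  by apply: filterS (dom_near bbp) => q bq /(bd_crd bq).
have crdp0 := (bd_crd ap).1 bp.
exists T; split.
- apply: mx_cvg => i j; rewrite mxE.
  apply: (@germ_cvg _ _ _ a p _ ('D_(@ebase R m.+1 i) (fun x => S x ord0 j))) => //.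
    exact: smooth_near_derive.
  near=> q => iq; have aq : dom a q by near: q; exact: dom_near.
  have SEq : \forall r \near q, crd b r = S (crd a r) by near: q; exact: near_nested.
  have sSq k : smooth_near (crd a q) (fun x => S x ord0 k).
    move: k; near: q; apply: filter_forall => k; exact: smooth_near_crd.
  apply: (jacobian_germ i j _ _).2.
    by apply: filterS (near_pull aq iq SEq) => x [_ xE _] /= ->; rewrite xE.
  by move=> k; exact: nbhs_singleton (smooth_near_diff (sSq k)).
- by move=> i; rewrite mxE; exact: (bd_tangential i bp ap (SEj ord0) S0).
(* [inc] is the inclusion of the hyperplane x_0 = 0 that underlies [bpnt]; the boundary chart change
   is the tail of S o inc. *)
- pose inc (y : 'rV[R]_m) : 'rV[R]_m.+1 := \row_j oapp (y ord0) 0 (unlift ord0 j).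
  have incp : inc (bcrd a p) = crd a p.
    apply/rowP => j; rewrite mxE; case: unliftP => [k ->|->] //=; first by rewrite mxE.
  have sinc j : smooth_near (bcrd a p) (fun y => inc y ord0 j).
    rewrite /inc; under eq_fun do rewrite mxE.
    by case: unlift => [k|] /=; [exact: smooth_near_coord|exact: smooth_near_cst].
  have dinc i j : 'D_(@ebase R m i) (fun y => inc y ord0 j) (bcrd a p) =
      (j == lift ord0 i)%:R.
    rewrite /inc; under eq_fun do rewrite mxE.
    case: unliftP => [k ->|->] /=; last by rewrite derive_cst.
    rewrite (inj_eq lift_inj).
    have <- : ('D_(@ebase R m i) id (bcrd a p)) ord0 k = (k == i)%:R.
      by rewrite derive_id mxE eqxx.
    by rewrite derive_mx ?mxE //; exact: derivable_id.
  have cinc : inc y @[y --> bcrd a p] --> crd a p.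
    rewrite -incp; apply: (@mx_cvg R 1 m.+1 _ (nbhs (bcrd a p)) inc _ (nbhs_filter _)).
    by move=> i j; rewrite (ord1 i); exact: (smooth_near_cvg (sinc j)).
  apply/matrixP => i j; rewrite /bjac.
  have [||_ ->] := @jacobian_germ R m m (bcrd b \o bpnt a)
    (fun y => \row_k S (inc y) ord0 (lift ord0 k)) (bcrd a p) i j.
  + have nH : \forall y \near bcrd a p, _ := cinc _ (pnt_near ap SE).
    apply: filterS nH => y /=.
    rewrite {1}/inc mxE unlift_none => /(_ (lexx 0)) [_ yE yS].
    by apply/rowP => k; rewrite !mxE -[in RHS]yE -yS.
  + move=> k; under eq_fun do rewrite mxE.
    have sk : smooth_near (bcrd a p) (fun y => S (inc y) ord0 (lift ord0 k)).
      apply: (@smooth_near_comp R m m.+1 (bcrd a p) inc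
        (fun x => S x ord0 (lift ord0 k))) => //.
      by rewrite incp; exact: sS.
    exact: nbhs_singleton (smooth_near_diff sk).
  rewrite !mxE; under [X in _ = 'D__ X _]eq_fun do rewrite mxE.
  have dS : differentiable (fun x => S x ord0 (lift ord0 j)) (inc (bcrd a p)).
    by rewrite incp; exact: nbhs_singleton (smooth_near_diff (sS _)).
  have di : differentiable inc (bcrd a p).
    apply: differentiable_row => k.
    exact: nbhs_singleton (smooth_near_diff (sinc k)).
  rewrite [RHS](derive_chain (@ebase R m i) di dS) incp (bigD1 (lift ord0 i)) //= dinc eqxx mulr1.
  by rewrite big1 ?addr0 // => k kn; rewrite dinc (negPf kn) mulr0.
- rewrite mxE; apply: derive_ge0.
    exact: nbhs_singleton (smooth_near_diff (sS _)).
  have bS : \forall q \near p, 0 <= S (crd a q) ord0 ord0.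
    by apply: filterS2 (dom_near bbp) (SEj ord0) => q bq <-; exact: crd_ge0.
  have n1 : \forall h \near (0 : R)^'+, 0 <= (h *: e0 + crd a p) ord0 ord0 ->
     0 <= S (h *: e0 + crd a p) ord0 ord0.
    apply: cvg_within.
    have nH : \forall h \near (0 : R), _ := ray_cvg e0 (pnt_near ap bS).
    by apply: filterS nH => h /= H /H [_ ->].
  near=> h; rewrite -[X in X <= _](_ : 0 = _); last first.
    by rewrite -(nbhs_singleton (SEj ord0)); apply/esym/(bd_crd bbp).
  near: h; near=> h; have h0 : 0 < h by near: h; exact: nbhs_right_gt.
  suff : 0 <= (h *: e0 + crd a p) ord0 ord0 by near: h.
  by rewrite !mxE !eqxx mulr1 crdp0 addr0 ltW.
- move=> j; rewrite (dcomp_germ bp ap (sS j) (SEj j)).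
  by apply/rowP => i; rewrite !mxE.
Unshelve. all: by end_near. Qed.

End boundary_jets.

(** * Comparison of charts and of defining functions along the boundary *)

Lemma jacobian_comp (R : realType) (k l n : nat) (f : 'rV[R]_k -> 'rV[R]_l)
    (g : 'rV[R]_l -> 'rV[R]_n) x y :
  f x = y -> differentiable f x -> differentiable g y ->
  'J (g \o f) x = 'J f x *m 'J g y.
Proof.
move=> <- df dg; apply/row_matrixP => i; rewrite row_mul !rowE /jacobian.
by rewrite !mul_rV_lin1 diff_comp.
Qed.

Lemma jacobian_ext (R : realType) (k l : nat) (f g : 'rV[R]_k -> 'rV[R]_l) x :
  (\forall y \near x, f y = g y) -> differentiable g x ->
  differentiable f x /\ 'J f x = 'J g x.
Proof.
move=> fg dg; have dc j : differentiable (fun y => g y ord0 j) x.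
  exact: (differentiable_comp dg (differentiable_coord _ _ _)).
split; first by apply: near_eq_differentiable dg; apply: filterS fg => y ->.
apply/matrixP => i j; have [_ E] := jacobian_germ i j fg dc.
exact: etrans E (esym (jacobian_row i j dg)).
Qed.

Lemma det_tail (R : comNzRingType) (m : nat) (T : 'M[R]_m.+1) :
  (forall i, T (lift ord0 i) ord0 = 0) -> \det T = T ord0 ord0 * \det (tail_mx T).
Proof.
move=> T0; rewrite (expand_det_col _ ord0) big_ord_recl big1 ?addr0; last first.
  by move=> i _; rewrite T0 mul0r.
rewrite /cofactor addn0 expr0 mul1r; congr (_ * \det _).
by apply/matrixP => i j; rewrite !mxE.
Qed.

Section comparison.
Variables (R : realType) (m : nat) (M : obmanifold R m).
Implicit Types (a b : chart M) (p q : M).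

Local Notation ncrd a := (fun q : M => crd a q ord0 ord0).
Local Notation e0 := (@ebase R m.+1 ord0).

Lemma transition_diff a b q : inn M q -> dom a q -> dom b q ->
  differentiable (crd b \o pnt a) (crd a q).
Proof.
move=> iq aq bq; have [S sS SE] := transition_germ aq bq.
apply: (jacobian_ext (g := S) _ _).1.
  by apply: filterS (near_pull aq iq SE) => x [_ xE _] /= ->; rewrite xE.
apply: differentiable_row => k.
exact: nbhs_singleton (smooth_near_diff (sS k)).
Qed.

Lemma transition_chain a b c q : inn M q -> dom a q -> dom b q -> dom c q ->
  'J (crd c \o pnt a) (crd a q) =
  'J (crd b \o pnt a) (crd a q) *m 'J (crd c \o pnt b) (crd b q).
Proof.
move=> iq aq bq cq.
have d1 := transition_diff iq aq bq.
have d2 := transition_diff iq bq cq.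
have fq : (crd b \o pnt a) (crd a q) = crd b q by rewrite /= crdK.
apply: etrans (jacobian_comp fq d1 d2); apply: (jacobian_ext _ _).2.
  by apply: filterS (near_pull aq iq (dom_near bq)) => x [_ _ _ bx] /=; rewrite crdK.
rewrite -fq in d2; exact: (differentiable_comp d1 d2).
Qed.

Lemma jacobian_id n (x : 'rV[R]_n) : 'J id x = 1%:M.
Proof.
apply/matrixP => i j; rewrite jacobian_row // -derive_row_coord // derive_id.
by rewrite !mxE eqxx eq_sym.
Qed.

Lemma transition_chart_id a q : inn M q -> dom a q ->
  'J (crd a \o pnt a) (crd a q) = 1%:M.
Proof.
move=> iq aq; rewrite -(jacobian_id (crd a q)); apply: (jacobian_ext _ _).2 => //.
by apply: filterS (near_pull aq iq (dom_near aq)) => x [_ xE _ _]; exact: xE.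
Qed.

(** Invertibility at the boundary comes from the limit of the relation J_ab J_ba = 1 over interior
    points. The orientation then gives det T >= 0 in the limit, hence det T > 0; as det T is the
    corner times the determinant of the tail and the corner is nonnegative, both factors are
    positive. *)
Lemma boundary_jacobian a b p : bd M p -> dom a p -> dom b p ->
  exists T : 'M[R]_m.+1, [/\ T \in unitmx,
    'J (crd b \o pnt a) (crd a q) @[q --> near_inn p] --> T,
    forall i, T (lift ord0 i) ord0 = 0, 0 < T ord0 ord0 &
    [/\ tail_mx T = bjac a b p, 0 < \det (tail_mx T) &
    forall j, Defs.dcomp a (fun q => crd b q ord0 j) p = \row_i T i j]].
Proof.
move=> bp ap bbp; have [T [JT T0 tT T00 dT]] := transition_jacobian bp ap bbp.
have [T' [JT' _ _ _ _]] := transition_jacobian bp bbp ap.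
have pr := near_inn_proper bp.
have TT' : T *m T' = 1%:M.
  have JJ := cvg_mulmx (FF := near_inn_filter p) JT JT'; apply/matrixP => i j.
  have c1 := @cvg_mx _ _ _ _ _ _ _ i j (near_inn_filter p) JJ.
  rewrite -(cvg_lim _ c1) //; apply: cvg_lim => //.
  apply: (@cvg_near_eq _ _ _ (fun=> (1%:M : 'M[R]_m.+1) i j)); last exact: cvg_cst.
  near=> q; have iq : inn M q by near: q; exact: near_inn_inn.
  have aq : dom a q by near: q; apply/near_near_inn/dom_near.
  have bq : dom b q by near: q; apply/near_near_inn/dom_near.
  by rewrite -transition_chain // transition_chart_id.
have [Tu _] := mulmx1_unit TT'.
have dT0 : 0 <= \det T.
  have c := cvg_det (FF := near_inn_filter p) JT; rewrite -(cvg_lim _ c) //; apply: limr_ge.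
    by apply/cvg_ex; exists (\det T).
  near=> q; have iq : inn M q by near: q; exact: near_inn_inn.
  have aq : dom a q by near: q; apply/near_near_inn/dom_near.
  have bq : dom b q by near: q; apply/near_near_inn/dom_near.
  by apply/ltW/transition_oriented => //; exact: inn_crd.
have {}dT0 : 0 < \det T.
  by rewrite lt_neqAle dT0 andbT eq_sym; rewrite unitmxE unitfE in Tu.
rewrite det_tail // in dT0.
have {}T00 : 0 < T ord0 ord0.
  rewrite lt_neqAle T00 andbT eq_sym; apply: contraTneq dT0 => ->.
  by rewrite mul0r ltxx.
by exists T; split => //; split => //; rewrite pmulr_rgt0 in dT0.
Unshelve. all: by end_near. Qed.

Lemma crd_smooth_fn a j : smooth_fn (dom a) (fun q => crd a q ord0 j).
Proof. by move=> b; rewrite /comp; have := @transition_smooth _ _ M b a j. Qed.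

Lemma ncrd_local_defining a : local_defining (dom a) (ncrd a).
Proof.
split; first exact: dom_open.
- exact: crd_smooth_fn.
- exact: crd_ge0.
- by move=> p ap; rewrite (bd_crd ap).
- move=> b p ap bp bbp; have [T [_ _ _ T00 [_ _ ->]]] := boundary_jacobian bp bbp ap.
  by apply: contraTneq T00 => /rowP /(_ ord0); rewrite !mxE => ->; rewrite ltxx.
Qed.

(** w is the x_0-derivative of rho at p; the tangential ones vanish. The mean value theorem on the
    normal segment down to the boundary gives the limit of rho/x_0, and w > 0 because it is a limit
    of nonnegative quotients and d rho does not vanish. *)
Lemma local_defining_cmp a p U rho : local_defining U rho -> U p -> bd M p ->
  dom a p -> exists2 w : R, 0 < w &
    Defs.dcomp a rho p = w *: e0 /\
    rho q / ncrd a q @[q --> near_inn p] --> w.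
Proof.
move=> [oU srho rho0 rhobd drho] Up bp ap.
have [F sF FE] := smooth_fn_germ oU Up ap srho.
have dE := dcomp_germ bp ap sF FE.
have nU : \forall q \near p, U q by exact: open_nbhs_nbhs.
have rbd : \forall q \near p, bd M q -> rho q = 0.
  by apply: filterS nU => q /rhobd [_ ].
set w := 'D_e0 F (crd a p).
have dw : Defs.dcomp a rho p = w *: e0.
  apply/rowP => i; rewrite dE !mxE; have [k ->|->] := unliftP ord0 i.
    by rewrite (bd_tangential k bp ap FE rbd) /= mulr0.
  by rewrite mulr1.
have p0 := (bd_crd ap).1 bp.
have crdc := crd_cvg ap.
have rat : rho q / ncrd a q @[q --> near_inn p] --> w.
  have [W [oW Wp CF]] := sF.
  (* The foot of the normal segment through q; rho vanishes there. *)
  pose u q := crd a q - ncrd a q *: e0.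
  have cu : u q @[q --> near_inn p] --> crd a p.
    rewrite -[X in _ --> X]subr0 -(scale0r e0) -p0.
    have crdc' : crd a q @[q --> near_inn p] --> crd a p.
      by apply: cvg_trans crdc; apply: cvg_app; exact: cvg_within.
    apply: cvgB => //; apply: cvg_scalemx; last exact: cvg_cst.
    exact: cvg_mx crdc'.
  have cw : crd a q @[q --> near_inn p] --> crd a p.
    by apply: cvg_trans crdc; apply: cvg_app; exact: cvg_within.
  have [c cc cE] := mean_value_cvg (near_inn_filter p) oW Wp (CF 1%N).1 cu cw.
  apply: (@cvg_near_eq _ _ _ (fun q => 'D_e0 F (c q))); last first.
    exact: (@cvg_comp _ _ _ c ('D_e0 F) _ _ _ cc (smooth_near_cvg (smooth_near_derive e0 sF))).
  have HF : \forall q \near p, rho q = F (crd a q) /\ (bd M q -> rho q = 0).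
    exact: filterI.
  have nu : \forall q \near near_inn p, _ := cu _ (pnt_near ap HF).
  have nd : \forall q \near near_inn p, _ := cc _ (smooth_near_diff sF).
  have nF : \forall q \near near_inn p, rho q = F (crd a q).
    exact: near_near_inn.
  near=> q; have iq : inn M q by near: q; exact: near_inn_inn.
  have aq : dom a q by near: q; apply/near_near_inn/dom_near.
  have q0 := inn_crd aq iq.
  have uE : crd a q - u q = ncrd a q *: e0 by rewrite /u opprB addrC subrK.
  have Fu : F (u q) = 0.
    have : 0 <= u q ord0 ord0 ->
      [/\ dom a (pnt a (u q)), crd a (pnt a (u q)) = u q &
        rho (pnt a (u q)) = F (crd a (pnt a (u q))) /\
        (bd M (pnt a (u q)) -> rho (pnt a (u q)) = 0)] by near: q.
    have u0 : u q ord0 ord0 = 0 by rewrite !mxE !eqxx mulr1 subrr.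
    rewrite u0 => /(_ (lexx 0)) [au ucE [rF r0]].
    by rewrite -[X in F X]ucE -rF r0 //; apply/(bd_crd au); rewrite ucE.
  have dcq : differentiable F (c q) by near: q.
  have : F (crd a q) - F (u q) = 'D_(crd a q - u q) F (c q) by near: q.
  rewrite uE Fu subr0 deriveE // linearZ /= -deriveE // => E.
  have -> : rho q = F (crd a q) by near: q.
  by rewrite E [_ *: _]mulrC mulfK // gt_eqF.
exists w => //.
rewrite lt_neqAle eq_sym; apply/andP; split.
  apply/eqP => w0; have := drho _ _ Up bp ap; rewrite dw w0 scale0r eqxx; exact.
have pr := near_inn_proper bp.
rewrite -(cvg_lim _ rat) //; apply: limr_ge; first by apply/cvg_ex; exists w.
near=> q; have iq : inn M q by near: q; exact: near_inn_inn.
have aq : dom a q by near: q; apply/near_near_inn/dom_near.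
apply: divr_ge0; last exact: crd_ge0.
by apply: rho0; near: q; exact: near_near_inn.
Unshelve. all: by end_near. Qed.

End comparison.

(** * The cocycle in a chart *)

Section cocycle_formula.
Variables (R : realType) (m : nat) (M : obmanifold R m).
Implicit Types (a b : chart M) (p q : M) (g h : cov2 M).

Local Notation ncrd a := (fun q : M => crd a q ord0 ord0).
Local Notation e0 := (@ebase R m.+1 ord0).

Lemma near_ncrd_gt0 a p : dom a p -> \forall q \near near_inn p, 0 < ncrd a q.
Proof.
move=> ap; near=> q; apply: inn_crd; last by near: q; exact: near_inn_inn.
by near: q; apply/near_near_inn/dom_near.
Unshelve. all: by end_near. Qed.

Lemma metric_defining_limits a p V r g h (A U : 'M[R]_m.+1) : bd M p -> dom a p ->
  local_defining V r -> V p ->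
  (ncrd a q ^+ 2 *: g a q) @[q --> near_inn p] --> A ->
  ((ncrd a q ^+ m.-1)^-1 *: (h a q - g a q)) @[q --> near_inn p] --> U ->
  exists2 w : R, 0 < w & [/\ Defs.dcomp a r p = w *: e0,
    r q / ncrd a q @[q --> near_inn p] --> w,
    (r q ^+ 2 *: g a q) @[q --> near_inn p] --> w ^+ 2 *: A &
    mu_ij r g h a q @[q --> near_inn p] --> (w ^+ m.-1)^-1 *: U].
Proof.
move=> bp ap ldr Vp gA hU; have [w w0 [dw rw]] := local_defining_cmp ldr Vp bp ap.
have FF := near_inn_filter p; exists w => //; split => //.
- apply: (@cvg_near_eq _ _ _ (fun q => (r q / ncrd a q) ^+ 2 *:
      (ncrd a q ^+ 2 *: g a q))).
    near=> q; have q0 : 0 < ncrd a q by near: q; exact: near_ncrd_gt0.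
    by rewrite scalerA -exprMn divfK // gt_eqF.
  by apply: cvg_scalemx => //; rewrite expr2; under eq_fun do rewrite expr2; exact: cvgM.
- apply: (@cvg_near_eq _ _ _ (fun q => ((r q / ncrd a q) ^+ m.-1)^-1 *:
      ((ncrd a q ^+ m.-1)^-1 *: (h a q - g a q)))).
    near=> q; have q0 : 0 < ncrd a q by near: q; exact: near_ncrd_gt0.
    by rewrite scalerA -invfM -exprMn divfK // gt_eqF.
  apply: cvg_scalemx => //; apply: cvgV; first by rewrite expf_neq0 // gt_eqF.
  elim: m.-1 => [|k IH]; first by under eq_fun do rewrite expr0; exact: cvg_cst.
  by rewrite exprS; under eq_fun do rewrite exprS; exact: cvgM.
Unshelve. all: by end_near. Qed.

(** The limits of the two families are the only input on g and h, so the formula applies to a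
    pullback as soon as its difference with g has a limit. The factor w between rho and x_0 is
    removed at the end by [nu_coef_scale]. *)
Lemma cocycle_formula a p (rho : M -> M -> R) g h gam (A U : 'M[R]_m.+1) :
  (0 < m)%N -> bd M p -> dom a p ->
  (exists2 V, V p & local_defining V (rho p)) ->
  A \in unitmx -> 0 < \det (tail_mx A) ->
  (ncrd a q ^+ 2 *: g a q) @[q --> near_inn p] --> A ->
  ((ncrd a q ^+ m.-1)^-1 *: (h a q - g a q)) @[q --> near_inn p] --> U ->
  cocycle_c rho g h a gam p = ((0 : R^o), (0 : 'rV[R]_m), (nu_coef A U e0 : R^o)).
Proof.
move=> m0 bp ap [V Vp ldr] Au tA gA hU.
have [w w0 [dw rw rg rU]] := metric_defining_limits bp ap ldr Vp gA hU.
have FF := near_inn_filter p; set r := rho p in ldr dw rw rg rU.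
have wAu : w ^+ 2 *: A \in unitmx.
  by rewrite unitmxZ // unitfE expf_neq0 // gt_eqF.
set A' := w ^+ 2 *: A in wAu rg; set U' := _ *: U in rU.
have tr_lim : mu_tr r g h a q @[q --> near_inn p] --> \tr (invmx A' *m U').
  (* The factor rho^-2 of [mu_tr] is absorbed into the inverse: rho^2 g, unlike g, has an invertible
     limit. In [mu0_ij] below, rho^2 is likewise moved onto g. *)
  apply: (@cvg_near_eq _ _ _ (fun q =>
    \tr (invmx (r q ^+ 2 *: g a q) *m mu_ij r g h a q))).
    have nr : \forall q \near near_inn p, r q / ncrd a q != 0.
      have wn0 : w != 0 by rewrite gt_eqF.
      have H := open_nbhs_nbhs (conj (@open_neq R 0) wn0).
      exact: (rw _ H).
    have nu := cvg_unitmx (FF := FF) rg wAu.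
    near=> q; have rq0 : r q != 0.
      have : r q / ncrd a q != 0 by near: q.
      by apply: contraNneq => ->; rewrite mul0r.
    have ru : r q ^+ 2 *: g a q \in unitmx by near: q.
    by rewrite /mu_tr (invmxZ ru) -scalemxAl mxtraceZ.
  by apply: cvg_mxtrace; apply: cvg_mulmx; [exact: cvg_invmx|exact: rU].
have mu0_lim : mu0_ij r g h a q @[q --> near_inn p] -->
    U' - ((m.+1)%:R^-1 * \tr (invmx A' *m U')) *: A'.
  rewrite /mu0_ij.
  have E q : mu_ij r g h a q - ((m.+1)%:R^-1 * r q ^+ 2 * mu_tr r g h a q) *: g a q
    = mu_ij r g h a q - ((m.+1)%:R^-1 * mu_tr r g h a q) *: (r q ^+ 2 *: g a q).
    by rewrite scalerA; congr (_ - _ *: _); rewrite mulrAC.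
  under eq_fun do rewrite E.
  apply: cvgB; first exact: rU.
  by apply: cvg_scalemx; [apply: cvgM; [exact: cvg_cst|exact: tr_lim]|exact: rg].
have gbE : gbar r g a p = A' by exact: (bval_mx_cvg bp rg).
have gooE : gbar_oo r g a p = tail_mx A' by rewrite /gbar_oo gbE.
rewrite /cocycle_c /c1 /c2 -/r gooE gbE dw (bval_cvg bp tr_lim).
rewrite (bval_mx_cvg bp mu0_lim) -(nu_coef_scale U e0 m0 w0 Au tA) -/A' -/U'.
rewrite /vol_sigma_X /nu_coef.
congr (_, _, _); rewrite /= ?scaler0 ?addr0 //.
rewrite /GRing.scale /=; set u := \tr _; set Q := (_ *m _) ord0 ord0.
by move: (volform _) (density1 _)^-1 Q => v d Q; ring.
Unshelve. all: by end_near. Qed.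

End cocycle_formula.

(** * Smooth families of matrices *)

Section smooth_matrices.
Variables (R : realType) (n : nat) (x : 'rV[R]_n).

Definition smooth_near_mx (k l : nat) (A : 'rV[R]_n -> 'M[R]_(k, l)) : Prop :=
  forall i j, smooth_near x (fun y => A y i j).

Lemma smooth_near_mulmx (k l r : nat) (A : 'rV[R]_n -> 'M[R]_(k, l))
    (B : 'rV[R]_n -> 'M[R]_(l, r)) :
  smooth_near_mx A -> smooth_near_mx B -> smooth_near_mx (fun y => A y *m B y).
Proof.
move=> sA sB i j; under eq_fun do rewrite mxE.
by apply: smooth_near_sum => s; exact: smooth_nearM.
Qed.

Lemma smooth_near_scalemx (k l : nat) (c : 'rV[R]_n -> R)
    (A : 'rV[R]_n -> 'M[R]_(k, l)) :
  smooth_near x c -> smooth_near_mx A -> smooth_near_mx (fun y => c y *: A y).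
Proof. by move=> sc sA i j; under eq_fun do rewrite mxE; exact: smooth_nearM. Qed.

Lemma smooth_near_submx (k l : nat) (A B : 'rV[R]_n -> 'M[R]_(k, l)) :
  smooth_near_mx A -> smooth_near_mx B -> smooth_near_mx (fun y => A y - B y).
Proof. by move=> sA sB i j; under eq_fun do rewrite !mxE; exact: smooth_nearB. Qed.

Lemma smooth_near_cstmx (k l : nat) (A : 'M[R]_(k, l)) : smooth_near_mx (fun=> A).
Proof. by move=> i j; exact: smooth_near_cst. Qed.

Lemma smooth_near_mxtrace (k : nat) (A : 'rV[R]_n -> 'M[R]_k) :
  smooth_near_mx A -> smooth_near x (fun y => \tr (A y)).
Proof. by move=> sA; exact: smooth_near_sum. Qed.

Lemma smooth_near_tail_mx (k : nat) (A : 'rV[R]_n -> 'M[R]_k.+1) :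
  smooth_near_mx A -> smooth_near_mx (fun y => tail_mx (A y)).
Proof. by move=> sA i j; under eq_fun do rewrite mxE; exact: sA. Qed.

Lemma smooth_near_mx_cvg (k l : nat) (A : 'rV[R]_n -> 'M[R]_(k, l)) :
  smooth_near_mx A -> A y @[y --> x] --> A x.
Proof.
move=> sA; apply: (@mx_cvg R k l _ (nbhs x) A (A x) (nbhs_filter x)) => i j.
exact: (smooth_near_cvg (sA i j)).
Qed.

Lemma smooth_near_invmx (k : nat) (A : 'rV[R]_n -> 'M[R]_k) :
  smooth_near_mx A -> A x \in unitmx -> smooth_near_mx (fun y => invmx (A y)).
Proof.
move=> sA Au i j.
have d0 : \det (A x) != 0 by rewrite unitmxE unitfE in Au.
have nu : \forall y \near x, A y \in unitmx.
  exact: (cvg_unitmx (FF := nbhs_filter x) (smooth_near_mx_cvg sA) Au).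
apply: (@smooth_near_ext _ _ _ (fun y => (\det (A y))^-1 * (\adj (A y)) i j)).
  by apply: filterS nu => y yu; rewrite /invmx yu [RHS]mxE.
apply: smooth_nearM.
  by apply: smooth_nearV => //; exact: smooth_near_det.
under eq_fun do rewrite mxE; apply: smooth_nearM; first exact: smooth_near_cst.
by apply: smooth_near_det => s t; under eq_fun do rewrite !mxE; exact: sA.
Qed.

Lemma smooth_near_nu_coef (m : nat) (A U : 'rV[R]_n -> 'M[R]_m.+1) d :
  smooth_near_mx A -> smooth_near_mx U -> A x \in unitmx ->
  0 < \det (tail_mx (A x)) -> smooth_near x (fun y => nu_coef (A y) (U y) d).
Proof.
move=> sA sU Au tA; have sI := smooth_near_invmx sA Au.
have sd : smooth_near x (fun y => \det (tail_mx (A y))).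
  by apply: smooth_near_det; exact: smooth_near_tail_mx.
have npos : \forall y \near x, 0 < \det (tail_mx (A y)).
  exact: (smooth_near_cvg sd (open_nbhs_nbhs (conj (@open_gt R 0) tA))).
have sT := smooth_near_mxtrace (smooth_near_mulmx sI sU).
apply: smooth_nearM.
  apply: smooth_nearM.
    (* The square root is rewritten as a real power, for which smoothness at positive values is
       known. *)
    apply: (@smooth_near_ext _ _ _ (fun y => \det (tail_mx (A y)) `^ 2^-1)).
      by apply: filterS npos => y y0; rewrite powR12_sqrt // ltW.
    exact: smooth_near_powR.
  apply: smooth_nearV; first exact: smooth_near_powR.
  by rewrite gt_eqF // powR_gt0.
apply: smooth_nearB.
  by do 2 (apply: smooth_nearM; first exact: smooth_near_cst).
apply: smooth_nearM; first exact: smooth_near_cst.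
apply: smooth_near_mulmx; last exact: smooth_near_cstmx.
apply: smooth_near_mulmx => //; apply: smooth_near_mulmx.
  by apply: smooth_near_mulmx => //; exact: smooth_near_cstmx.
apply: smooth_near_submx => //; apply: smooth_near_scalemx => //.
by apply: smooth_nearM => //; exact: smooth_near_cst.
Qed.

End smooth_matrices.

(** * Boundary values of ALH metrics and of their differences *)

Section class_members.
Variables (R : realType) (m : nat) (M : obmanifold R m).
Implicit Types (a b : chart M) (p q : M) (g h : cov2 M).

Local Notation ncrd a := (fun q : M => crd a q ord0 ord0).
Local Notation e0 := (@ebase R m.+1 ord0).

Lemma dcomp_ncrd a p : bd M p -> dom a p -> Defs.dcomp a (ncrd a) p = e0.
Proof.
move=> bp ap; have pr := near_inn_proper bp.
have [w _ [-> rw]] := local_defining_cmp (ncrd_local_defining a) ap bp ap.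
have r1 : ncrd a q / ncrd a q @[q --> near_inn p] --> (1 : R).
  apply: (@cvg_near_eq _ R _ (fun=> 1 : R)); last exact: cvg_cst.
  near=> q; have q0 : 0 < ncrd a q by near: q; exact: near_ncrd_gt0.
  by rewrite divff // gt_eqF.
have <- : (1 : R) = w by rewrite -(cvg_lim _ rw) // -(cvg_lim _ r1).
by rewrite scale1r.
Unshelve. all: by end_near. Qed.

Lemma mx_germ a p (D : set M) (f : M -> 'M[R]_m.+1) : dom a p ->
  (forall i j, exists2 F, smooth_near (crd a p) F &
     \forall q \near p, D q -> f q i j = F (crd a q)) ->
  exists2 A : 'rV[R]_m.+1 -> 'M[R]_m.+1, smooth_near_mx (crd a p) A &
    \forall q \near p, D q -> f q = A (crd a q).
Proof.
move=> ap H; have H' (ij : 'I_m.+1 * 'I_m.+1) :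
    exists F, smooth_near (crd a p) F /\
     \forall q \near p, D q -> f q ij.1 ij.2 = F (crd a q).
  by have [F sF FE] := H ij.1 ij.2; exists F.
have [F FE] := choice H'; exists (fun x => \matrix_(i, j) F (i, j) x).
  by move=> i j; under eq_fun do rewrite mxE; exact: (FE (i, j)).1.
have : \forall q \near p, forall ij, D q -> f q ij.1 ij.2 = F ij (crd a q).
  by apply: filter_forall => ij; exact: (FE ij).2.
apply: filterS => q E Dq; apply/matrixP => i j; rewrite mxE; exact: (E (i, j)).
Qed.

(* The properties of the boundary value of x_0^2 g in a chart: the third one
   is the ALH condition for the defining function x_0. *)
Definition ALH_mx (A : 'M[R]_m.+1) : Prop :=
  [/\ A \in unitmx, A^T = A, invmx A ord0 ord0 = 1 & 0 < \det (tail_mx A)].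

Lemma mx_germ_cvg a p (f : M -> 'M[R]_m.+1) A : dom a p ->
  smooth_near_mx (crd a p) A ->
  (\forall q \near p, inn M q -> f q = A (crd a q)) ->
  f q @[q --> near_inn p] --> A (crd a p).
Proof.
move=> ap sA fA; apply: mx_cvg => i j.
apply: (germ_cvg ap (sA i j)).
by apply: filterS fA => q E /E ->.
Qed.

Lemma ALH_germ g a p : ALH g -> bd M p -> dom a p ->
  exists A : 'rV[R]_m.+1 -> 'M[R]_m.+1, [/\ smooth_near_mx (crd a p) A,
    \forall q \near p, inn M q -> ncrd a q ^+ 2 *: g a q = A (crd a q) &
    ALH_mx (A (crd a p))].
Proof.
move=> [[[gsp gsm gtr] gcc] gALH] bp ap.
have ld := ncrd_local_defining a.
have [gext gdet] := gcc _ _ ld a p ap bp ap.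
have [A sA AE] : exists2 A : 'rV[R]_m.+1 -> 'M[R]_m.+1, smooth_near_mx (crd a p) A &
    \forall q \near p, inn M q -> ncrd a q ^+ 2 *: g a q = A (crd a q).
  apply: mx_germ => // i j; have [F sF FE] := extends_germ ap (gext i j).
  by exists F => //; apply: filterS FE => q E /E <-; rewrite mxE.
exists A; split => //.
have pr := near_inn_proper bp.
have gA := mx_germ_cvg ap sA AE.
have gbE : gbar (ncrd a) g a p = A (crd a p) by exact: (bval_mx_cvg bp gA).
set B := A _ in gA gbE *; rewrite gbE in gdet.
have Bu : B \in unitmx by rewrite unitmxE unitfE.
have B1 : invmx B ord0 ord0 = 1.
  have := gALH _ _ ld a p ap bp ap; rewrite dcomp_ncrd // gbE -rowE => <-.
  rewrite !mxE (bigD1 ord0) //= big1 ?addr0; last first.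
    by move=> i i0; rewrite !mxE (negPf i0) mulr0.
  by rewrite !mxE !eqxx mulr1.
have near_sp : \forall q \near near_inn p, sym_posdef (ncrd a q ^+ 2 *: g a q).
  near=> q; have iq : inn M q by near: q; exact: near_inn_inn.
  have aq : dom a q by near: q; apply/near_near_inn/dom_near.
  have q0 := inn_crd aq iq; have [gT gp] := gsp a q aq iq.
  split; first by rewrite linearZ /= gT.
  move=> v v0; rewrite -scalemxAr -scalemxAl mxE; apply: mulr_gt0 (gp v v0).
  by rewrite exprn_gt0.
split => //.
- apply/matrixP => i j; rewrite mxE.
  have c1 := @cvg_mx _ _ _ _ _ _ _ i j (near_inn_filter p) gA.
  have c2 := @cvg_mx _ _ _ _ _ _ _ j i (near_inn_filter p) gA.
  rewrite -(cvg_lim _ c1) //; apply/esym/cvg_lim => //.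
  apply: cvg_near_eq c2; apply: filterS near_sp => q [E _].
  by rewrite -[in RHS]E [RHS]mxE.
(* By the ALH condition this is the determinant of the full matrix: nonnegative as a limit of
   determinants of positive definite matrices, and nonzero by conformal compactness. *)
- rewrite tail_mx_det // lt_neqAle eq_sym gdet /=.
  have c := cvg_det (FF := near_inn_filter p) gA.
  rewrite -(cvg_lim _ c) //; apply: limr_ge; first by apply/cvg_ex; exists (\det B).
  by apply: filterS near_sp => q /posdef_det_gt0 /ltW.
Unshelve. all: by end_near. Qed.

Lemma asymp_germ g0 g h a p : (0 < m)%N -> asymp_equiv g0 g -> asymp_equiv g0 h ->
  bd M p -> dom a p ->
  exists2 U : 'rV[R]_m.+1 -> 'M[R]_m.+1, smooth_near_mx (crd a p) U &
    \forall q \near p, inn M q ->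
      (ncrd a q ^+ m.-1)^-1 *: (h a q - g a q) = U (crd a q).
Proof.
move=> m0 g0g g0h bp ap; apply: mx_germ => // i j.
have ld := ncrd_local_defining a.
have germ k : asymp_equiv g0 k -> exists2 F, smooth_near (crd a p) F &
    \forall q \near p, inn M q -> ncrd a q ^+ 2 * g0 a q i j -
       ncrd a q ^+ 2 * k a q i j = ncrd a q ^+ m.+1 * F (crd a q).
  move=> g0k; have [V [u [oV Vp su E]]] := g0k _ _ ld a p ap bp ap i j.
  have [F sF FE] := smooth_fn_germ oV Vp ap su; exists F => //.
  have nV : \forall q \near p, V q by exact: open_nbhs_nbhs.
  by apply: filterS2 nV FE => q Vq <- iq; exact: E.
have [F sF FE] := germ _ g0g; have [H sH HE] := germ _ g0h.
exists (fun x => F x - H x); first exact: smooth_nearB.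
near=> q => iq; have aq : dom a q by near: q; exact: dom_near.
have q0 := inn_crd aq iq; have qn0 : ncrd a q != 0 by rewrite gt_eqF.
have e1 : inn M q -> ncrd a q ^+ 2 * g0 a q i j - ncrd a q ^+ 2 * g a q i j =
   ncrd a q ^+ m.+1 * F (crd a q) by near: q.
have e2 : inn M q -> ncrd a q ^+ 2 * g0 a q i j - ncrd a q ^+ 2 * h a q i j =
   ncrd a q ^+ m.+1 * H (crd a q) by near: q.
have {}e1 := e1 iq; have {}e2 := e2 iq.
(* The order n of [asymp_equiv] splits as 2 + (n-2); [m.-1] is n-2 because m > 0. *)
have em : ncrd a q ^+ m.+1 = ncrd a q ^+ 2 * ncrd a q ^+ m.-1.
  by rewrite -exprD add2n prednK.
rewrite em in e1 e2; have q2 : ncrd a q ^+ 2 != 0 by rewrite expf_neq0.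
rewrite !mxE; apply: (mulfI (expf_neq0 m.-1 qn0)).
rewrite mulVKf ?expf_neq0 //; apply: (mulfI q2); rewrite mulrBr.
by rewrite mulrA mulrBr -e1 -e2; ring.
Unshelve. all: by end_near. Qed.

End class_members.

(** * Cocycle identities and covariance *)

Section cocycle.
Variables (R : realType) (m : nat) (M : obmanifold R m).
Hypothesis m_gt0 : (0 < m)%N.
Implicit Types (a b : chart M) (p q : M) (g h k : cov2 M).

Local Notation ncrd a := (fun q : M => crd a q ord0 ord0).
Local Notation e0 := (@ebase R m.+1 ord0).

Definition x0_limit a p g (A : 'M[R]_m.+1) : Prop :=
  (ncrd a q ^+ 2 *: g a q) @[q --> near_inn p] --> A.

Definition x0_difference a p g h (U : 'M[R]_m.+1) : Prop :=
  ((ncrd a q ^+ m.-1)^-1 *: (h a q - g a q)) @[q --> near_inn p] --> U.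

Lemma x0_difference_opp a p g h U :
  x0_difference a p g h U -> x0_difference a p h g (- U).
Proof.
move=> gh; rewrite /x0_difference.
have -> : (fun q => (ncrd a q ^+ m.-1)^-1 *: (g a q - h a q)) =
  (fun q => - ((ncrd a q ^+ m.-1)^-1 *: (h a q - g a q))).
  by apply/funext => q; rewrite -scalerN opprB.
by have FF := near_inn_filter p; apply: cvgN.
Qed.

Lemma x0_difference_add a p g h k U V : x0_difference a p g h U ->
  x0_difference a p h k V -> x0_difference a p g k (U + V).
Proof.
move=> gh hk; rewrite /x0_difference.
have -> : (fun q => (ncrd a q ^+ m.-1)^-1 *: (k a q - g a q)) =
  (fun q => (ncrd a q ^+ m.-1)^-1 *: (h a q - g a q) +
            (ncrd a q ^+ m.-1)^-1 *: (k a q - h a q)).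
  by apply/funext => q; rewrite -scalerDr [in RHS]addrC addrA subrK.
by have FF := near_inn_filter p; apply: cvgD.
Qed.

Lemma ncrd_cvg a p : bd M p -> dom a p -> ncrd a q @[q --> near_inn p] --> (0 : R).
Proof.
move=> bp ap; have FF := near_inn_filter p.
rewrite -[X in _ --> X]((bd_crd ap).1 bp).
apply: (@cvg_mx _ _ _ _ _ (crd a)); apply: cvg_trans (crd_cvg ap).
by apply: cvg_app; exact: cvg_within.
Qed.

Lemma ncrd_exp_cvg a p i : bd M p -> dom a p ->
  ncrd a q ^+ i.+1 @[q --> near_inn p] --> (0 : R).
Proof.
move=> bp ap; have FF := near_inn_filter p; have c := ncrd_cvg bp ap.
elim: i => [|i IH]; first by under eq_fun do rewrite expr1.
rewrite -[X in _ --> X](mulr0 (0 : R)).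
by under eq_fun do rewrite exprS; exact: cvgM.
Qed.

(** x_0^2 (h - g) is x_0^n times a convergent family, so it tends to 0: this is why A is common to g
    and h. *)
Lemma x0_limit_add a p g h A U : bd M p -> dom a p ->
  x0_limit a p g A -> x0_difference a p g h U -> x0_limit a p h A.
Proof.
move=> bp ap gA ghU; have FF := near_inn_filter p.
apply: (@cvg_near_eq _ _ _ (fun q => ncrd a q ^+ 2 *: g a q + ncrd a q ^+ m.+1 *:
    ((ncrd a q ^+ m.-1)^-1 *: (h a q - g a q)))).
  near=> q; have q0 : 0 < ncrd a q by near: q; exact: near_ncrd_gt0.
  have em : ncrd a q ^+ m.+1 = ncrd a q ^+ 2 * ncrd a q ^+ m.-1.
    by rewrite -exprD add2n prednK.
  by rewrite scalerA em mulfK ?expf_neq0 ?gt_eqF // -scalerDr addrC subrK.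
rewrite -[X in _ --> X]addr0 -(scale0r U); apply: cvgD; first exact: gA.
by apply: cvg_scalemx; [exact: ncrd_exp_cvg|exact: ghU].
Unshelve. all: by end_near. Qed.

Lemma nu_coef_formula a p (rho : M -> M -> R) g h gam A U : bd M p -> dom a p ->
  (exists2 V, V p & local_defining V (rho p)) -> ALH_mx A ->
  x0_limit a p g A -> x0_difference a p g h U ->
  cocycle_c rho g h a gam p = ((0 : R^o), (0 : 'rV[R]_m), (nu_coef A U e0 : R^o)).
Proof. by move=> bp ap hr [Au _ _ tA]; exact: cocycle_formula. Qed.

Variables (G : set (cov2 M)).
Hypothesis hG : ALH_class G.

Lemma class_ALH g : G g -> ALH g.
Proof. by have [g0 _ ->] := hG; case. Qed.

Lemma class_germs g h a p : G g -> G h -> bd M p -> dom a p ->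
  exists A U : 'rV[R]_m.+1 -> 'M[R]_m.+1, [/\ smooth_near_mx (crd a p) A,
    smooth_near_mx (crd a p) U,
    \forall q \near p, inn M q -> ncrd a q ^+ 2 *: g a q = A (crd a q),
    \forall q \near p, inn M q ->
      (ncrd a q ^+ m.-1)^-1 *: (h a q - g a q) = U (crd a q) &
    ALH_mx (A (crd a p))].
Proof.
have [g0 _ ->] := hG; move=> [Ag g0g] [_ g0h] bp ap.
have [A [sA AE gA]] := ALH_germ Ag bp ap.
have [U sU UE] := asymp_germ m_gt0 g0g g0h bp ap.
by exists A, U.
Qed.

Lemma class_limits g h a p : G g -> G h -> bd M p -> dom a p ->
  exists A U : 'M[R]_m.+1, [/\ ALH_mx A, x0_limit a p g A, x0_limit a p h A &
    x0_difference a p g h U].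
Proof.
move=> Gg Gh bp ap; have [A [U [sA sU AE UE gA]]] := class_germs Gg Gh bp ap.
exists (A (crd a p)), (U (crd a p)).
have lA : x0_limit a p g (A (crd a p)) by exact: mx_germ_cvg.
have dU : x0_difference a p g h (U (crd a p)) by exact: mx_germ_cvg.
by split => //; exact: x0_limit_add dU.
Qed.

Variable (rho : M -> M -> R).
Hypothesis hrho : forall p, bd M p -> exists2 U, U p & local_defining U (rho p).
Local Notation c := (cocycle_c rho).

Lemma cocycle_opp g h : G g -> G h ->
  tform_eq (conf_class G) (c h g) (tform_opp (c g h)).
Proof.
move=> Gg Gh a gam p _ bp ap.
have [A [U [gA lg lh dU]]] := class_limits Gg Gh bp ap.
rewrite /tform_opp (nu_coef_formula gam bp ap (hrho bp) gA lg dU).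
rewrite (nu_coef_formula gam bp ap (hrho bp) gA lh (x0_difference_opp dU)) nu_coefN.
by congr (_, _, _); rewrite ?oppr0.
Qed.

Lemma cocycle_add g h k : G g -> G h -> G k ->
  tform_eq (conf_class G) (c g k) (tform_add (c g h) (c h k)).
Proof.
move=> Gg Gh Gk a gam p _ bp ap.
have [A [U [gA lg lh dU]]] := class_limits Gg Gh bp ap.
(* A' is set aside: c(h, k) is computed with A, also a limit of x_0^2 h, so that the three
   coefficients share one A and linearity applies. *)
have [A' [V [gA' lh' lk dV]]] := class_limits Gh Gk bp ap.
rewrite /tform_add (nu_coef_formula gam bp ap (hrho bp) gA lg dU).
rewrite (nu_coef_formula gam bp ap (hrho bp) gA lg (x0_difference_add dU dV)).
rewrite (nu_coef_formula gam bp ap (hrho bp) gA lh dV) nu_coefD.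
by congr (_, _, _); rewrite ?addr0.
Qed.

(** The extension F p may change with p, smoothness being local. Composing it with the inclusion of
    the hyperplane x_0 = 0 gives the extension in boundary coordinates. *)
Lemma smooth_bd_germ a (f : M -> R) (F : M -> 'rV[R]_m.+1 -> R) :
  (forall p, bd M p -> dom a p -> smooth_near (crd a p) (F p) /\
    \forall q \near p, bd M q -> f q = F p (crd a q)) -> smooth_bd a f.
Proof.
move=> fF _ [p [ap bp] <-]; have [sF FE] := fF p bp ap.
pose inc (y : 'rV[R]_m) : 'rV[R]_m.+1 := \row_j oapp (y ord0) 0 (unlift ord0 j).
have inc_crd q : dom a q -> bd M q -> inc (bcrd a q) = crd a q.
  move=> aq bq; apply/rowP => j; rewrite mxE.
  case: unliftP => [i ->|->] /=; first by rewrite mxE.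
  by rewrite (bd_crd aq).1.
have sinc j : smooth_near (bcrd a p) (fun y => inc y ord0 j).
  rewrite /inc; under eq_fun do rewrite mxE.
  by case: unlift => [i|] /=; [exact: smooth_near_coord|exact: smooth_near_cst].
have cinc : inc y @[y --> bcrd a p] --> crd a p.
  rewrite -(inc_crd p) //.
  apply: (@mx_cvg R 1 m.+1 _ (nbhs (bcrd a p)) inc _ (nbhs_filter _)) => i j.
  by rewrite (ord1 i); exact: (smooth_near_cvg (sinc j)).
have [W [oW Wp CF]] : smooth_near (bcrd a p) (fun y => F p (inc y)).
  by apply: (@smooth_near_comp R m m.+1 (bcrd a p) inc (F p)) => //; rewrite inc_crd.
have [V [oV Vp VE]] := near_open (cinc _ (pnt_near ap FE)).
exists (W `&` V), (fun y => F p (inc y)); split => //.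
- exact: openI.
- by move=> k; apply: Ck_subset (CF k) => y [].
- move=> y [_ Vy] [q [aq bq] qy].
  have : 0 <= inc y ord0 ord0 -> [/\ dom a (pnt a (inc y)),
      crd a (pnt a (inc y)) = inc y &
      bd M (pnt a (inc y)) -> f (pnt a (inc y)) = F p (crd a (pnt a (inc y)))].
    exact: VE y Vy.
  rewrite -qy inc_crd // (bd_crd aq).1 // lexx => /(_ isT) [_ _ E].
  have bE : bpnt a (bcrd a q) = q by rewrite /bpnt -/(inc _) inc_crd // crdK.
  by rewrite /= bE; rewrite crdK // in E; exact: E.
Qed.

Lemma smooth_near_mx_crd a p (A : 'rV[R]_m.+1 -> 'M[R]_m.+1) : dom a p ->
  smooth_near_mx (crd a p) A -> \forall q \near p, smooth_near_mx (crd a q) A.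
Proof.
move=> ap sA; apply: filter_forall => i; apply: filter_forall => j.
exact: smooth_near_crd.
Qed.

(** The extensions A and U found at p also compute the limits at every boundary point q near p, so
    the coefficient at q is the smooth function nu_coef (A x) (U x) e_0 at x = crd a q. *)
Lemma cocycle_smooth g h a gam : G g -> G h ->
  smooth_bd a (fun p => tnu (c g h a gam p)).
Proof.
move=> Gg Gh.
have H p : exists F, bd M p -> dom a p -> smooth_near (crd a p) F /\
    \forall q \near p, bd M q -> tnu (c g h a gam q) = F (crd a q).
  have [[bp ap]|nbp] := pselect (bd M p /\ dom a p); last first.
    by exists (fun=> 0) => bp ap; case: nbp.
  have [A [U [sA sU AE UE [Au As A1 tA]]]] := class_germs Gg Gh bp ap.
  exists (fun x => nu_coef (A x) (U x) e0) => _ _.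
  split; first exact: smooth_near_nu_coef.
  near=> q => bq; have aq : dom a q by near: q; exact: dom_near.
  have [A' [U' [gA' lg lh dU]]] := class_limits Gg Gh bq aq.
  rewrite (nu_coef_formula gam bq aq (hrho bq) gA' lg dU) /tnu /=.
  have AE' : \forall r \near q, inn M r -> ncrd a r ^+ 2 *: g a r = A (crd a r).
    by near: q; exact: near_nested.
  have UE' : \forall r \near q, inn M r ->
      (ncrd a r ^+ m.-1)^-1 *: (h a r - g a r) = U (crd a r).
    by near: q; exact: near_nested.
  have sA' : smooth_near_mx (crd a q) A.
    by near: q; exact: smooth_near_mx_crd.
  have sU' : smooth_near_mx (crd a q) U by near: q; exact: smooth_near_mx_crd.
  have pr := near_inn_proper bq.
  have cA := mx_germ_cvg aq sA' AE'; have cU := mx_germ_cvg aq sU' UE'.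
  have -> : A' = A (crd a q) by rewrite -(bval_mx_cvg bq lg) (bval_mx_cvg bq cA).
  by have -> : U' = U (crd a q) by rewrite -(bval_mx_cvg bq dU) (bval_mx_cvg bq cU).
have [F HF] := choice H.
exact: (smooth_bd_germ HF).
Unshelve. all: by end_near. Qed.

(** The first coordinate of chart b serves as a defining function in chart a: it rescales A and U by
    powers of w, and the transformation law of the metrics identifies the results with T B T^T and T
    V T^T. The covariance is then [nu_coef_scale] followed by [nu_coef_congr]. *)
Lemma cocycle_chart_change g h a b gam p : G g -> G h -> bd M p -> dom a p ->
  dom b p -> c g h a gam p = chart_change (bjac a b p) (c g h b gam p).
Proof.
move=> Gg Gh bp ap bbp.
have [A [U [gA lg lh dU]]] := class_limits Gg Gh bp ap.
have [B [V [gB lgb lhb dV]]] := class_limits Gg Gh bp bbp.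
have [T [Tu JT T0 T00 [tT dT dcT]]] := boundary_jacobian bp ap bbp.
have FF := near_inn_filter p; have pr := near_inn_proper bp.
have [w w0 [dw rw rg rU]] := metric_defining_limits bp ap
  (ncrd_local_defining b) bbp lg dU.
have eT : e0 *m T^T = w *: e0.
  rewrite -dw dcT; apply/rowP => i; rewrite -rowE !mxE; reflexivity.
have [Ag Ah] := (class_ALH Gg, class_ALH Gh).
have trans k q : ALH k -> inn M q -> dom a q -> dom b q ->
    k a q = 'J (crd b \o pnt a) (crd a q) *m k b q *m ('J (crd b \o pnt a) (crd a q))^T.
  by move=> [[[_ _ +] _] _] iq aq bq; apply.
have nab : \forall q \near near_inn p, [/\ inn M q, dom a q & dom b q].
  near=> q; split; near: q; first exact: near_inn_inn.
    exact/near_near_inn/dom_near.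
  exact/near_near_inn/dom_near.
have wA : w ^+ 2 *: A = T *m B *m T^T.
  rewrite -(bval_mx_cvg bp rg); apply: bval_mx_cvg => //.
  apply: (@cvg_near_eq _ _ _ (fun q => 'J (crd b \o pnt a) (crd a q) *m
     (ncrd b q ^+ 2 *: g b q) *m ('J (crd b \o pnt a) (crd a q))^T)).
    by apply: filterS nab => q [iq aq bq]; rewrite (trans g q) // -scalemxAr -scalemxAl.
  by apply: cvg_mulmx; [apply: cvg_mulmx|exact: cvg_trmx].
have wU : (w ^+ m.-1)^-1 *: U = T *m V *m T^T.
  rewrite -(bval_mx_cvg bp rU); apply: bval_mx_cvg => //.
  apply: (@cvg_near_eq _ _ _ (fun q => 'J (crd b \o pnt a) (crd a q) *m
     ((ncrd b q ^+ m.-1)^-1 *: (h b q - g b q)) *m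
     ('J (crd b \o pnt a) (crd a q))^T)).
    apply: filterS nab => q [iq aq bq]; rewrite /mu_ij (trans g q) // (trans h q) //.
    by rewrite -scalemxAr -scalemxAl mulmxBr mulmxBl.
  by apply: cvg_mulmx; [apply: cvg_mulmx|exact: cvg_trmx].
rewrite (nu_coef_formula gam bp ap (hrho bp) gA lg dU).
rewrite (nu_coef_formula gam bp bbp (hrho bp) gB lgb dV) /chart_change /tsig /tmu /tnu /=.
congr (_, _, _); rewrite ?mulr0 ?mul0mx ?scaler0 //.
have [Au _ _ tA] := gA; have [Bu _ _ tB] := gB.
rewrite -(nu_coef_scale U e0 m_gt0 w0 Au tA) wA wU -eT.
by rewrite nu_coef_congr // tT.
Unshelve. all: by end_near. Qed.

Lemma cocycle_slots g h a gam p : tsig (c g h a gam p) = 0 /\ tmu (c g h a gam p) = 0.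
Proof. by split; rewrite /tsig /tmu /= ?scaler0 addr0. Qed.

Lemma cocycle_tractor_form g h : G g -> G h ->
  is_tractor_form (conf_class G) (c g h).
Proof.
move=> Gg Gh; split.
- move=> a gam _; split; last exact: cocycle_smooth.
  + apply: (smooth_bd_germ (F := fun _ => fun=> 0)) => p bp ap.
    split; first exact: smooth_near_cst.
    by apply: nearW => q _; have [-> _] := cocycle_slots g h a gam q.
  + move=> i; apply: (smooth_bd_germ (F := fun _ => fun=> 0)) => p bp ap.
    split; first exact: smooth_near_cst.
    by apply: nearW => q _; have [_ ->] := cocycle_slots g h a gam q; rewrite mxE.
- by move=> a b gam p _ bp ap bbp; exact: cocycle_chart_change.
(* With zero sigma and mu slots, a change of splitting leaves the triple unchanged. *)
- move=> gam gam' f _ _ _ _ a p _ _.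
  have [s0 m0] := cocycle_slots g h a gam p.
  rewrite /splitting_change s0 m0 trmx0 mulmx0 mxE !mulr0 scale0r !addr0 subr0.
  by rewrite -[LHS]/(c g h a gam p) -s0 -m0; case: (c g h a gam p) => [[]].
Qed.

End cocycle.

(** * Bump functions *)

Section bump_function.
Variables (R : realType) (m : nat) (M : obmanifold R m).
Implicit Types (a b : chart M) (p q : M).

Lemma germs_smooth_fn (V : set M) (f : M -> R) :
  (forall b q, dom b q -> V q -> exists2 F, smooth_near (crd b q) F &
     \forall r \near q, f r = F (crd b r)) -> smooth_fn V f.
Proof.
move=> fF b _ [q [bq Vq] <-]; have [F [W [oW Wq CF]] FE] := fF b q bq Vq.
have [Z [oZ Zq ZE]] := near_open (pnt_near bq FE).
exists (W `&` Z), F; split => //.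
- exact: openI.
- by move=> k; apply: Ck_subset (CF k) => y [].
- move=> y [_ Zy] [r [br Vr] ry]; subst y.
  have [_ _ E] := ZE _ Zy (crd_ge0 br).
  by rewrite /= E !crdK.
Qed.

(** A product over the coordinates, nonzero on a cube about c: this fits the norm of row vectors,
    which is the maximum norm. *)
Definition box_bump (c : 'rV[R]_m.+1) (e : R) (x : 'rV[R]_m.+1) : R :=
  \prod_j expinv 1 (e ^+ 2 - (x ord0 j - c ord0 j) ^+ 2).

Lemma smooth_near_box_bump c e x : smooth_near x (box_bump c e).
Proof.
exists setT; split => //; first exact: openT.
move=> k; apply: Ck_prod; first exact: openT.
move=> j; apply: Ck_expinv; first exact: openT.
have oT := @openT 'rV[R]_m.+1.
have Cd : Ck k setT (fun x : 'rV[R]_m.+1 => x ord0 j - c ord0 j).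
  by apply: CkD => //; [exact: Ck_coord|exact: Ck_cst].
have Cm : Ck k setT (fun x : 'rV[R]_m.+1 =>
    - 1 * ((x ord0 j - c ord0 j) * (x ord0 j - c ord0 j))).
  by apply: CkM => //; [exact: Ck_cst|exact: CkM].
apply: Ck_ext (CkD oT (Ck_cst k setT (e ^+ 2)) Cm) => // y _.
by rewrite mulN1r expr2.
Qed.

Lemma box_bump_center c e : 0 < e -> 0 < box_bump c e c.
Proof.
move=> e0; apply: prodr_gt0 => j _; apply: expinv1_gt0.
by rewrite subrr expr0n subr0 exprn_gt0.
Qed.

Lemma box_bump_support c e x : 0 < e -> box_bump c e x != 0 -> `|x - c| <= e.
Proof.
move=> e0; rewrite /box_bump prodf_seq_neq0 => /allP H.
rewrite [leLHS]/Num.Def.normr /= mx_normrE; apply: bigmax_le; first exact: ltW.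
move=> [i j] _ /=; rewrite (ord1 i) !mxE.
have := H j (mem_index_enum _); rewrite /=.
rewrite real_leNgt ?num_real //; apply: contra => lt.
rewrite expinv_le0 // subr_le0 -[leRHS]real_normK ?num_real //.
by apply: lerXn2r; rewrite ?nnegrE ?(ltW e0) // ltW.
Qed.

(** The last clause turns functions on a chart domain, such as coordinates, into global ones.
    Extension by 0 is smooth because the support lies in the image of a compact piece of the chart,
    which is closed in M as M is Hausdorff. *)
Lemma bump_function a p : dom a p -> exists f : M -> R,
  [/\ 0 < f p, forall q, f q != 0 -> dom a q &
     forall phi : M -> R, smooth_fn (dom a) phi ->
       smooth_fn setT (fun q => f q * phi q)].
Proof.
move=> ap; have [Z [oZ E]] := @crd_image _ _ M a.
have Zp : Z (crd a p).
  have : (crd a @` dom a) (crd a p) by exists p.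
  by rewrite E => -[].
have /nbhs_ballP [d /= d0 dZ] : nbhs (crd a p) Z by exact: open_nbhs_nbhs.
(* Half the radius, so that the closed cube lies in the open set Z. *)
pose e := d / 2; have e0 : 0 < e by rewrite divr_gt0.
set c := crd a p in Zp dZ.
pose B : set 'rV[R]_m.+1 := [set x | `|x - c| <= e] `&` @halfspace R m.
have Bim : B `<=` crd a @` dom a.
  rewrite E => x [xe x0]; split => //; apply: dZ.
  rewrite -ball_normE /ball_ /= distrC; apply: le_lt_trans xe _.
  by rewrite /e ltr_pdivrMr // ltr_pMr // ltr1n.
have cB : compact B.
  apply: bounded_closed_compact.
    exists (`|c| + e); split; first exact: num_real.
    move=> y ye x [xe _] /=.
    rewrite -[x](subrK c); apply: le_trans (ler_normD _ _) _.
    by apply: ltW; apply: le_lt_trans ye; rewrite addrC lerD2l.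
  apply: closedI.
    have -> : [set x : 'rV[R]_m.+1 | `|x - c| <= e] =
        (fun x => `|x - c|) @^-1` [set y | y <= e] by [].
    apply: closed_comp; last exact: closed_le.
    move=> x _; have cx : (y - c) @[y --> x] --> x - c.
      by apply: (@cvgB _ _ _ (nbhs x)); [exact: cvg_id|exact: cvg_cst].
    exact: (@cvg_norm _ _ _ (nbhs x) _ _ _ cx).
  have -> : @halfspace R m = (fun x : 'rV[R]_m.+1 => x ord0 ord0) @^-1` [set y | 0 <= y].
    by [].
  apply: closed_comp; last exact: closed_ge.
  move=> x _; exact: coord_continuous.
have clK : closed (pnt a @` B).
  apply: compact_closed; first exact: pt_hausdorff.
  apply: continuous_compact cB; apply: continuous_subspaceW Bim _.
  exact: pnt_continuous.
pose f q := if `[< dom a q >] then box_bump c e (crd a q) else 0.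
have fa q : dom a q -> f q = box_bump c e (crd a q) by move=> aq; rewrite /f asboolT.
have f0 q : ~ (pnt a @` B) q -> f q = 0.
  move=> nK; have [aq|naq] := pselect (dom a q); last by rewrite /f asboolF.
  rewrite fa //; apply/eqP; apply: contra_notT nK => b0; exists (crd a q); last exact: crdK.
  by split; [exact: box_bump_support|exact: crd_ge0].
exists f; split.
- by rewrite fa //; exact: box_bump_center.
- by move=> q; rewrite /f; case: asboolP => //; rewrite eqxx.
move=> phi sphi; apply: germs_smooth_fn => b q bq _.
have [aq|naq] := pselect (dom a q).
  have [F sF FE] := smooth_fn_germ (@dom_open _ _ M a) aq bq sphi.
  have [S sS SE] := transition_germ bq aq.
  exists (fun x => box_bump c e (S x) * F x).
    apply: smooth_nearM => //; apply: smooth_near_comp => //.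
    exact: smooth_near_box_bump.
  near=> r; rewrite fa; last by near: r; exact: dom_near.
  congr (box_bump c e _ * _); near: r; [exact: SE|exact: FE].
exists (fun=> 0); first exact: smooth_near_cst.
have nK : ~ (pnt a @` B) q.
  by move=> [x /Bim [r ar <-]]; rewrite crdK // => rq; apply: naq; rewrite -rq.
have oK : open (~` (pnt a @` B)) by exact: closed_openC.
by apply: filterS (open_nbhs_nbhs (conj oK nK)) => r /f0 ->; rewrite mul0r.
Unshelve. all: by end_near. Qed.

End bump_function.

(** * Diffeomorphisms asymptotic to the identity *)

Section diffeomorphisms_near_identity.
Variables (R : realType) (m : nat) (M : obmanifold R m).
Implicit Types (a b : chart M) (p q : M) (h : cov2 M).

Local Notation ncrd a := (fun q : M => crd a q ord0 ord0).
Local Notation e0 := (@ebase R m.+1 ord0).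

Lemma Diff0_germ k Phi a p (f : M -> R) : Diff0 k Phi -> bd M p -> dom a p ->
  smooth_fn setT f -> exists2 u, smooth_near (crd a p) u &
    \forall q \near p, f (Phi q) = f q + ncrd a q ^+ k * u (crd a q).
Proof.
move=> [_ HPhi] bp ap sf.
have [V [u [oV Vp su E]]] := HPhi f sf _ _ (ncrd_local_defining a) p ap bp.
have [F sF FE] := smooth_fn_germ oV Vp ap su; exists F => //.
have nV : \forall q \near p, V q by exact: open_nbhs_nbhs.
apply: filterS2 nV FE => q Vq <-; have {}E : f (Phi q) - f q = _ := E q Vq I.
by rewrite -E addrC subrK.
Qed.

(* Only globally smooth functions may be used as coordinates: the coordinates
   of Phi are recovered as quotients (f x_j) / f for a bump function f. *)
Lemma Diff0_crd k Phi a p : Diff0 k.+1 Phi -> bd M p -> dom a p ->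
  exists2 Xi : 'rV[R]_m.+1 -> 'rV[R]_m.+1,
    forall j, smooth_near (crd a p) (fun x => Xi x ord0 j) &
    \forall q \near p, dom a (Phi q) /\
      crd a (Phi q) = crd a q + ncrd a q ^+ k.+1 *: Xi (crd a q).
Proof.
move=> dPhi bp ap; have [f [fp fdom fsm]] := bump_function ap.
have sf : smooth_fn setT f.
  have -> : f = (fun q => f q * 1) by apply/funext => q; rewrite mulr1.
  apply: (fsm (fun=> 1)); apply: germs_smooth_fn => b q _ _; exists (fun=> 1).
    exact: smooth_near_cst.
  by apply: nearW.
have [F sF FE] := smooth_fn_germ openT I ap sf.
have [u su uE] := Diff0_germ dPhi bp ap sf.
have vj j : exists v, smooth_near (crd a p) v /\
    \forall q \near p, f (Phi q) * crd a (Phi q) ord0 j =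
      f q * crd a q ord0 j + ncrd a q ^+ k.+1 * v (crd a q).
  have [v sv vE] := Diff0_germ dPhi bp ap (fsm _ (crd_smooth_fn (a := a) j)).
  by exists v.
have [v vE] := choice vj.
have p0 := (bd_crd ap).1 bp.
(* D is f o Phi in the chart. It equals f > 0 at p, so it is positive nearby; since f is nonzero
   only in [dom a], this also keeps Phi q in the chart. *)
pose D x := F x + x ord0 ord0 ^+ k.+1 * u x.
have sD : smooth_near (crd a p) D.
  apply: smooth_nearD => //; apply: smooth_nearM => //; apply: smooth_nearX.
  exact: smooth_near_coord.
have Dp : 0 < D (crd a p).
  by rewrite /D p0 exprS !mul0r addr0 -(nbhs_singleton FE).
have nD : \forall q \near p, 0 < D (crd a q).
  exact: (crd_cvg ap (smooth_near_cvg sD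
    (open_nbhs_nbhs (conj (@open_gt R 0) Dp)))).
(* With s = x_0^(k+1) and y_j the coordinates of Phi, D y_j = f x_j + s v_j and f = D - s u give y_j
   = x_j + s (v_j - x_j u) / D. *)
exists (fun x => \row_j ((v j x - x ord0 j * u x) / D x)).
  move=> j; under eq_fun do rewrite mxE.
  apply: smooth_nearM; last by apply: smooth_nearV; rewrite // gt_eqF.
  apply: smooth_nearB; first exact: (vE j).1.
  by apply: smooth_nearM => //; exact: smooth_near_coord.
have nv : \forall q \near p, forall j, f (Phi q) * crd a (Phi q) ord0 j =
      f q * crd a q ord0 j + ncrd a q ^+ k.+1 * v j (crd a q).
  by apply: filter_forall => j; exact: (vE j).2.
near=> q; have Dq : 0 < D (crd a q) by near: q.
have fPhi : f (Phi q) = D (crd a q).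
  rewrite /D; have <- : f q = F (crd a q) by near: q.
  by near: q.
split; first by apply: fdom; rewrite fPhi gt_eqF.
apply/rowP => j; rewrite !mxE.
have : forall j, f (Phi q) * crd a (Phi q) ord0 j =
      f q * crd a q ord0 j + ncrd a q ^+ k.+1 * v j (crd a q) by near: q.
move=> /(_ j); rewrite fPhi.
have -> : f q = D (crd a q) - ncrd a q ^+ k.+1 * u (crd a q).
  rewrite /D addrK; by near: q.
have Dn0 : D (crd a q) != 0 by rewrite gt_eqF.
move: (D _) (v j _) (u _) (_ ^+ _) Dn0 (crd a (Phi q) _ _) (crd a q ord0 j).
move=> d w z s d0 y x E; apply: (mulfI d0); rewrite E; field.
exact: d0.
Unshelve. all: by end_near. Qed.

Lemma Diff0_fixes k Phi a p : Diff0 k.+1 Phi -> bd M p -> dom a p -> Phi p = p.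
Proof.
move=> dPhi bp ap; have [Xi _ XE] := Diff0_crd dPhi bp ap.
have [aPhi E] := nbhs_singleton XE.
rewrite -(crdK aPhi) E (bd_crd ap).1 // exprS mul0r scale0r addr0.
exact: crdK.
Qed.

End diffeomorphisms_near_identity.

(** An exact identity instead of an expansion with remainder: after division by s every term on the
    right has a limit as s tends to 0. *)
Lemma first_order_congruence (R : realType) (n : nat) (s l L : R)
    (H K B : 'M[R]_n) : s != 0 -> l = 1 + s * L ->
  let N := H + s *: K in
  s^-1 *: (l *: ((1%:M + s *: B) *m N *m (1%:M + s *: B)^T) - H) =
  L *: H + l *: (K + (B *m N + N *m B^T + s *: (B *m N *m B^T))).
Proof.
move=> s0 lE N.
suff -> : l *: ((1%:M + s *: B) *m N *m (1%:M + s *: B)^T) - H =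
    s *: (L *: H + l *: (K + (B *m N + N *m B^T + s *: (B *m N *m B^T)))).
  by rewrite scalerA mulVf // scale1r.
have -> : (1%:M + s *: B) *m N *m (1%:M + s *: B)^T =
    H + s *: (K + (B *m N + N *m B^T + s *: (B *m N *m B^T))).
  have -> : (1%:M + s *: B)^T = 1%:M + s *: B^T.
    by rewrite [LHS]linearD /= linearZ /= trmx1.
  rewrite mulmxDl mul1mx mulmxDr mulmx1 mulmxDl.
  rewrite -!scalemxAl -!scalemxAr.
  rewrite !scalerDr addrA -/N -!addrA; congr (_ + (_ + (_ + _))).
move: (K + _) => P; apply/matrixP => i j; rewrite !mxE lE; ring.
Qed.

(** * The boundary value of the difference between a metric and its pullback *)

Section pullback.
Variables (R : realType) (m : nat) (M : obmanifold R m).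
Hypothesis m_gt0 : (0 < m)%N.
Implicit Types (a b : chart M) (p q : M) (h : cov2 M).

Local Notation ncrd a := (fun q : M => crd a q ord0 ord0).
Local Notation e0 := (@ebase R m.+1 ord0).

Lemma crd_smooth_cvg a p F : dom a p -> smooth_near (crd a p) F ->
  F (crd a q) @[q --> near_inn p] --> F (crd a p).
Proof. by move=> ap sF; apply: (germ_cvg ap sF); apply: nearW. Qed.

Lemma derive_coord (n : nat) (x : 'rV[R]_n) i j :
  'D_(@ebase R n i) (fun y : 'rV[R]_n => y ord0 j) x = (i == j)%:R.
Proof.
have <- : ('D_(@ebase R n i) id x) ord0 j = (i == j)%:R.
  by rewrite derive_id mxE eqxx eq_sym.
by rewrite derive_mx ?mxE //; exact: derivable_id.
Qed.

(** With x_0^k taken out, the derivatives of Xi carry one more factor x_0, so only the term coming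
    from the derivative of x_0^(k+1) survives on the boundary. *)
Lemma jacobian_perturbation k (Xi : 'rV[R]_m.+1 -> 'rV[R]_m.+1) x :
  (forall j, differentiable (fun y => Xi y ord0 j) x) ->
  differentiable (fun y : 'rV[R]_m.+1 => y + y ord0 ord0 ^+ k.+1 *: Xi y) x /\
  'J (fun y : 'rV[R]_m.+1 => y + y ord0 ord0 ^+ k.+1 *: Xi y) x =
  1%:M + x ord0 ord0 ^+ k *: (k.+1%:R *: (e0^T *m Xi x) + x ord0 ord0 *:
    \matrix_(i, j) 'D_(@ebase R m.+1 i) (fun y => Xi y ord0 j) x).
Proof.
move=> dXi; pose c (y : 'rV[R]_m.+1) := y ord0 ord0.
have dc : differentiable c x by exact: differentiable_coord.
have dck : differentiable (c ^+ k.+1) x by exact: differentiableX.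
have dj j : differentiable (fun y : 'rV[R]_m.+1 => y ord0 j) x.
  exact: differentiable_coord.
have comp j : (fun y : 'rV[R]_m.+1 => (y + y ord0 ord0 ^+ k.+1 *: Xi y) ord0 j) =
   (fun y : 'rV[R]_m.+1 => y ord0 j) + (c ^+ k.+1) * (fun y => Xi y ord0 j).
  by apply/funext => y; rewrite !mxE !fctE.
have dM j : differentiable (c ^+ k.+1 * (fun y => Xi y ord0 j)) x.
  exact: differentiableM.
have dP : differentiable (fun y : 'rV[R]_m.+1 => y + y ord0 ord0 ^+ k.+1 *: Xi y) x.
  apply: differentiable_row => j; rewrite comp.
  exact: differentiableD.
split => //; apply/matrixP => i j; rewrite jacobian_row // comp.
rewrite deriveD; [|exact: diff_derivable|exact: diff_derivable].
rewrite derive_coord deriveM; [|exact: diff_derivable|exact: diff_derivable].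
rewrite deriveX; last exact: diff_derivable.
rewrite derive_coord !mxE big_ord1 !mxE eqxx /= exprfctE /GRing.scale /=.
have aux (u v w D z y l : R) : v + (y * z * D + w * (l * z * u)) =
  v + z * (l * (u * w) + y * D) by ring.
by rewrite /c [in LHS]exprS; exact: aux.
Qed.

Lemma near_inn_Diff0 k Phi a p (P : M -> Prop) : Diff0 k.+1 Phi -> bd M p ->
  dom a p -> (\forall q \near p, P q) -> \forall q \near p, P (Phi q).
Proof.
move=> dPhi bp ap nP; have [[[cPhi _] _] _] := dPhi.
have c : Phi q @[q --> p] --> Phi p by exact: cPhi.
by apply: c; rewrite (Diff0_fixes dPhi bp ap).
Qed.

(** With s = x_0^n, the family s^-1 (x_0^2 Phi^* h - x_0^2 h) has the form of
    [first_order_congruence]; L, B and K tend to -2 xi_0, (n+1) e_0^T xi and 0. *)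
Lemma pullback_difference h Phi a p A : ALH h -> Diff0 m.+2 Phi -> bd M p ->
  dom a p -> A^T = A -> x0_limit a p h A ->
  exists xi : 'rV[R]_m.+1, let E := e0^T *m xi *m A in
    x0_difference a p h (pullback Phi h)
      ((m.+2)%:R *: (E + E^T) - (2 * xi ord0 ord0) *: A).
Proof.
move=> Ah dPhi bp ap As hA; have FF := near_inn_filter p.
have pr := near_inn_proper bp.
have [Xi sXi XiE] := Diff0_crd dPhi bp ap.
have [H [sH HE _]] := ALH_germ Ah bp ap.
have AE : A = H (crd a p).
  by rewrite -(bval_mx_cvg bp hA) (bval_mx_cvg bp (mx_germ_cvg ap sH HE)).
have htr : forall a b p, dom a p -> dom b p -> inn M p ->
    let J := 'J (crd b \o pnt a) (crd a p) in h a p = J *m h b p *m J^T.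
  by case: Ah => -[[]].
exists (Xi (crd a p)) => E; set xi := Xi (crd a p) in E *.
pose x q := ncrd a q; pose s q := x q ^+ m.+1.
pose z q := Xi (crd a q) ord0 ord0.
(* x_0 o Phi = x_0 (1 + s z), so l is the square of x_0 / (x_0 o Phi), and L below is (l - 1)/s. *)
pose l q := ((1 + s q * z q) ^+ 2)^-1.
pose L q := - (2 * z q + s q * z q ^+ 2) * l q.
pose B q : 'M[R]_m.+1 := (m.+2)%:R *: (e0^T *m Xi (crd a q)) + x q *:
    \matrix_(i, j) 'D_(@ebase R m.+1 i) (fun y => Xi y ord0 j) (crd a q).
pose K q := (s q)^-1 *: (H (crd a (Phi q)) - H (crd a q)).
pose N q := H (crd a q) + s q *: K q.
have x_0 : x q @[q --> near_inn p] --> (0 : R) by exact: ncrd_cvg.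
have s_0 : s q @[q --> near_inn p] --> (0 : R) by exact: ncrd_exp_cvg.
have zc : z q @[q --> near_inn p] --> xi ord0 ord0.
  exact: (crd_smooth_cvg ap (sXi ord0)).
have tc : 1 + s q * z q @[q --> near_inn p] --> (1 : R).
  rewrite -[X in _ --> X]addr0 -[X in _ + X](mul0r (xi ord0 ord0)).
  by apply: cvgD; [exact: cvg_cst|exact: cvgM].
have lc : l q @[q --> near_inn p] --> (1 : R).
  rewrite -[X in _ --> X]invr1 -(expr1n R 2) expr2; apply: cvgV.
    by rewrite mulr1 oner_neq0.
  by under eq_fun do rewrite expr2; exact: cvgM.
have Lc : L q @[q --> near_inn p] --> - (2 * xi ord0 ord0).
  rewrite -[X in _ --> X]mulr1 -[X in - X](addr0 (2 * xi ord0 ord0)).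
  rewrite -[X in - (_ + X)](mul0r (xi ord0 ord0 * xi ord0 ord0)).
  apply: cvgM => //; apply: cvgN; apply: cvgD; first by apply: cvgM => //; exact: cvg_cst.
  by under eq_fun do rewrite expr2; apply: cvgM => //; exact: cvgM.
have Hc : H (crd a q) @[q --> near_inn p] --> A.
  by rewrite AE; apply: mx_cvg => i j; exact: (crd_smooth_cvg ap (sH i j)).
have Xc : Xi (crd a q) @[q --> near_inn p] --> xi.
  by apply: mx_cvg => i j; rewrite (ord1 i); exact: (crd_smooth_cvg ap (sXi j)).
have Bc : B q @[q --> near_inn p] --> (m.+2)%:R *: (e0^T *m xi).
  rewrite -[X in _ --> X]addr0 -(scale0r (\matrix_(i, j)
    'D_(@ebase R m.+1 i) (fun y => Xi y ord0 j) (crd a p))).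
  apply: cvg_addmx.
    by apply: cvg_scalemx; [exact: cvg_cst|apply: cvg_mulmx => //; exact: cvg_cst].
  apply: cvg_scalemx => //; apply: mx_cvg => i j; under eq_fun do rewrite mxE.
  rewrite mxE; apply: (crd_smooth_cvg ap (F := 'D_(@ebase R m.+1 i) _)).
  exact: smooth_near_derive.
(* The displacement x_0^(n+1) Xi has one factor x_0 more than s; the mean value theorem carries this
   over to H. *)
have Kc : K q @[q --> near_inn p] --> (0 : 'M[R]_m.+1).
  have cP : crd a (Phi q) @[q --> near_inn p] --> crd a p.
    have c0 : Phi q @[q --> p] --> p.
      have [[[cPhi _] _] _] := dPhi.
      by rewrite -[X in _ --> X](Diff0_fixes dPhi bp ap); exact: cPhi.
    have c1 := @cvg_comp _ _ _ Phi (crd a) _ _ _ c0 (crd_cvg ap).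
    by apply: cvg_trans c1; apply: cvg_app; exact: cvg_within.
  have c0 : crd a q @[q --> near_inn p] --> crd a p.
    by apply: cvg_trans (crd_cvg ap); apply: cvg_app; exact: cvg_within.
  apply: mx_cvg => i j; have [W [oW Wp CW]] := sH i j.
  have [c cc cE] := mean_value_cvg FF oW Wp (CW 1%N).1 c0 cP.
  rewrite [X in _ --> X]mxE -[X in _ --> X](mul0r (\sum_r xi ord0 r *
    'D_(@ebase R m.+1 r) (fun y => H y i j) (crd a p))).
  apply: (@cvg_near_eq _ _ _ (fun q => x q * \sum_r Xi (crd a q) ord0 r *
    'D_(@ebase R m.+1 r) (fun y => H y i j) (c q))); last first.
    apply: cvgM; first exact: x_0.
    apply: cvg_sumr => r; apply: cvgM; first exact: (crd_smooth_cvg ap (sXi r)).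
    exact: (@cvg_comp _ _ _ c _ _ _ _ cc
      (smooth_near_cvg (smooth_near_derive (@ebase R m.+1 r) (sH i j)))).
  have nd : \forall q \near near_inn p, _ := cc _ (smooth_near_diff (sH i j)).
  have nX : \forall q \near near_inn p, dom a (Phi q) /\
      crd a (Phi q) = crd a q + ncrd a q ^+ m.+2 *: Xi (crd a q).
    exact: near_near_inn.
  near=> q; have q0 : 0 < ncrd a q by near: q; exact: near_ncrd_gt0.
  have dq : differentiable (fun y => H y i j) (c q) by near: q.
  have [_ PE] : dom a (Phi q) /\
      crd a (Phi q) = crd a q + ncrd a q ^+ m.+2 *: Xi (crd a q) by near: q.
  have : H (crd a (Phi q)) i j - H (crd a q) i j =
    'D_(crd a (Phi q) - crd a q) (fun y => H y i j) (c q) by near: q.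
  have -> : crd a (Phi q) - crd a q = ncrd a q ^+ m.+2 *: Xi (crd a q).
    by rewrite PE addrC addKr.
  rewrite derive_linear // /K !mxE => ->.
  rewrite !mulr_sumr; apply: eq_bigr => r _; rewrite !mxE /s /x [_ ^+ m.+2]exprS.
  have S0 : ncrd a q ^+ m.+1 != 0 by rewrite expf_neq0 // gt_eqF.
  have aux (S' y' w' D' : R) : S' != 0 -> y' * (w' * D') = S'^-1 * (y' * S' * w' * D').
    by move=> ?; field.
  exact: aux S0.
have Nc : N q @[q --> near_inn p] --> A.
  rewrite -[X in _ --> X]addr0 -(scale0r (0 : 'M[R]_m.+1)).
  by apply: cvg_addmx; [exact: Hc|exact: (cvg_scalemx s_0 Kc)].
rewrite /x0_difference.
apply: (@cvg_near_eq _ _ _ (fun q => L q *: H (crd a q) + l q *: (K q +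
  (B q *m N q + N q *m (B q)^T + s q *: (B q *m N q *m (B q)^T))))); last first.
  have -> : (m.+2)%:R *: (E + E^T) - (2 * xi ord0 ord0) *: A =
     - (2 * xi ord0 ord0) *: A + 1 *: (0 +
      (((m.+2)%:R *: (e0^T *m xi)) *m A + A *m ((m.+2)%:R *: (e0^T *m xi))^T +
       0 *: (((m.+2)%:R *: (e0^T *m xi)) *m A *m ((m.+2)%:R *: (e0^T *m xi))^T))).
    rewrite scale0r addr0 add0r scale1r scaleNr addrC; congr (_ + _).
    rewrite linearZ /= -scalemxAl -scalemxAr -scalerDr; congr (_ *: (_ + _)).
    by rewrite /E !trmx_mul trmxK As mulmxA.
  have BT := cvg_trmx (FF := FF) Bc.
  have BN := cvg_mulmx (FF := FF) Bc Nc.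
  apply: cvg_addmx; first exact: (cvg_scalemx Lc Hc).
  apply: (cvg_scalemx lc); apply: (cvg_addmx Kc); apply: cvg_addmx.
    by apply: (cvg_addmx BN); exact: (cvg_mulmx Nc BT).
  exact: (cvg_scalemx s_0 (cvg_mulmx BN BT)).
have nXi : \forall q \near p, forall j, smooth_near (crd a q) (fun y => Xi y ord0 j).
  by apply: filter_forall => j; exact: (smooth_near_crd ap (sXi j)).
have nPhi : \forall q \near p, inn M (Phi q) ->
    ncrd a (Phi q) ^+ 2 *: h a (Phi q) = H (crd a (Phi q)).
  exact: (near_inn_Diff0 dPhi bp ap HE).
have nt : \forall q \near near_inn p, 0 < 1 + s q * z q.
  exact: (tc _ (open_nbhs_nbhs (conj (@open_gt R 0) (@ltr01 R)))).
near=> q; have iq : inn M q by near: q; exact: near_inn_inn.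
have aq : dom a q by near: q; apply/near_near_inn/dom_near.
have XEq : \forall r \near q, dom a (Phi r) /\
    crd a (Phi r) = crd a r + ncrd a r ^+ m.+2 *: Xi (crd a r).
  by near: q; apply/near_near_inn/near_nested.
have [aPq PqE] := nbhs_singleton XEq.
have tq : 0 < 1 + s q * z q by near: q.
have xq : 0 < x q by exact: inn_crd.
have xn0 : x q != 0 by rewrite gt_eqF.
have sE : s q = x q ^+ 2 * x q ^+ m.-1 by rewrite -exprD add2n prednK.
have sn0 : s q != 0 by rewrite expf_neq0.
have xPq : ncrd a (Phi q) = x q * (1 + s q * z q).
  by rewrite PqE !mxE /s /z mulrDr mulr1 mulrA -exprS.
have iPq : inn M (Phi q).
  by apply: (crd_gt0_inn aPq); rewrite xPq mulr_gt0.
have hq : h a q = (x q ^+ 2)^-1 *: H (crd a q).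
  have <- : ncrd a q ^+ 2 *: h a q = H (crd a q).
    by move: iq; near: q; exact: near_near_inn.
  by rewrite scalerA mulVf ?expf_neq0 // scale1r.
have NE : N q = H (crd a (Phi q)).
  by rewrite /N /K scalerA divff // scale1r addrC subrK.
have hPq : h a (Phi q) = ((x q * (1 + s q * z q)) ^+ 2)^-1 *: N q.
  have E2 : ncrd a (Phi q) ^+ 2 *: h a (Phi q) = H (crd a (Phi q)).
    by move: iPq; near: q; exact: near_near_inn.
  rewrite NE -E2 xPq scalerA mulVf ?scale1r // expf_neq0 // mulf_neq0 //.
  by rewrite gt_eqF.
have sXq : forall j, smooth_near (crd a q) (fun y => Xi y ord0 j).
  by near: q; exact: near_near_inn.
have [dPsi JPsi] := @jacobian_perturbation m.+1 Xi (crd a q)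
  (fun j => nbhs_singleton (smooth_near_diff (sXq j))).
set Psi := (fun y : 'rV[R]_m.+1 => _) in dPsi JPsi.
have pE : pullback Phi h a q = 'J Psi (crd a q) *m h a (Phi q) *m ('J Psi (crd a q))^T.
  (* [pullback] uses the chosen chart b at Phi q; as Phi q also lies in [dom a], the chain rule and
     the transformation law of h replace b by a. *)
  rewrite /pullback; set b := chart_at (Phi q).
  have bq : dom b (Phi q) by exact: dom_chart_at.
  have PsiE : Psi (crd a q) = crd a (Phi q) by rewrite PqE.
  have d2 := transition_diff iPq aPq bq.
  have -> : 'J (crd b \o Phi \o pnt a) (crd a q) =
      'J Psi (crd a q) *m 'J (crd b \o pnt a) (crd a (Phi q)).
    apply: etrans (jacobian_comp PsiE dPsi d2); apply: (jacobian_ext _ _).2.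
      apply: filterS (near_pull aq iq XEq) => y [ay yE _ [aPy PyE]] /=.
      by rewrite -[Psi y](_ : crd a (Phi (pnt a y)) = _) ?crdK // PyE yE.
    by rewrite -PsiE in d2; exact: (differentiable_comp dPsi d2).
  by rewrite (htr a b (Phi q)) // trmx_mul !mulmxA.
have lE : l q = 1 + s q * L q.
  by rewrite /L /l; field; rewrite gt_eqF.
rewrite -(first_order_congruence (H (crd a q)) (K q) (B q) sn0 lE).
rewrite pE JPsi hPq hq -scalemxAr -scalemxAl -/(s q) -/(B q) -/(N q).
have aux1 (X Y t : R) : (X * Y)^-1 * (t ^+ 2)^-1 = Y^-1 * (X * t ^+ 2)^-1.
  by rewrite !(invfM X) mulrA [Y^-1 * _]mulrC.
have aux2 (X Y : R) : (X * Y)^-1 = Y^-1 * X^-1 by rewrite invfM mulrC.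
rewrite !scalerBr !scalerA /l exprMn sE; congr (_ *: _ - _ *: _).
  exact: aux1.
exact: aux2.
Unshelve. all: by end_near. Qed.

End pullback.

Theorem corollary3p15 (R : realType) (m : nat) (hm : (3 <= m.+1)%N)
    (M : obmanifold R m) (G : set (cov2 M)) (hG : ALH_class G)
    (rho : M -> M -> R)
    (hrho : forall p, bd M p -> exists2 U, U p & local_defining U (rho p)) :
  let C := conf_class G in
  let c := cocycle_c rho in
  [/\ forall g h, G g -> G h -> is_tractor_form C (c g h),
      forall g h, G g -> G h -> tform_eq C (c h g) (tform_opp (c g h)),
      forall g h k, G g -> G h -> G k ->
        tform_eq C (c g k) (tform_add (c g h) (c h k))
    & forall g h Phi, G g -> G h -> Diff0 m.+2 Phi ->
        tform_eq C (c g h) (c g (pullback Phi h))].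
Proof.
have m_gt0 : (0 < m)%N by rewrite -ltnS; apply: leq_trans hm.
split.
- by move=> g h Gg Gh; apply: cocycle_tractor_form.
- by move=> g h Gg Gh; apply: cocycle_opp.
- by move=> g h k Gg Gh Gk; apply: cocycle_add.
move=> g h Phi Gg Gh dPhi a gam p _ bp ap.
have [A [U [gA lg lh dU]]] := class_limits m_gt0 hG Gg Gh bp ap.
have [Au As A1 _] := gA.
(* Here A enters as the limit of x_0^2 h; it is also that of x_0^2 g, so the term added to U is of
   the form that [nu_coef_vector_field] annihilates. *)
have [xi dxi] := pullback_difference m_gt0 (class_ALH hG Gh) dPhi bp ap As lh.
rewrite (nu_coef_formula m_gt0 gam bp ap (hrho p bp) gA lg dU).
rewrite (nu_coef_formula m_gt0 gam bp ap (hrho p bp) gA lg (x0_difference_add dU dxi)).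
by rewrite nu_coefD nu_coef_vector_field // addr0.
Qed.
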